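(* Let $(M^n,g)$ be a compact, connected, oriented $n$-dimensional Riemannian manifold without boundary, isometrically immersed in $\mathbb{R}^{n+1}$, and let $p>\frac n2$. Then for any $k>0$, there exists $\varepsilon=\varepsilon(k,n,\|K\|_{2p})>0$, where $K$ is the sectional curvature of $M$, such that if $$\|\mathrm{Ric}-kg\|_\infty\leq\varepsilon ,$$ then $M$ is homeomorphic to $\mathbb{S}^n$.
   Context: $\mathbb{R}^{n+1}$ carries its canonical Euclidean metric; manifolds and immersions are smooth. $\mathrm{Ric}$ is the Ricci tensor of $(M,g)$ and $\|\mathrm{Ric}-kg\|_\infty$ is the sup over $M$ of the pointwise norm of the symmetric bilinear form $\mathrm{Ric}-kg$. $\|K\|_{2p}$ is the $L^{2p}$-norm over $M$ of the sectional curvature, i.e. of the function $x\mapsto\max|K(P)|$, the maximum being over $2$-planes $P\subset T_xM$. $\mathbb{S}^n$ is the standard $n$-sphere. *)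

(* Defs.v *)
From HB Require Import structures.
From mathcomp Require Import all_boot all_order all_algebra.
From mathcomp Require Import all_classical all_reals all_analysis.

Set Implicit Arguments.
Unset Strict Implicit.
Unset Printing Implicit Defensive.

Import Order.TTheory GRing.Theory Num.Theory.
Import numFieldNormedType.Exports.

Local Open Scope classical_set_scope.
Local Open Scope ring_scope.

(* A derivative is C^k as soon as all its evaluations D_v f are, the spaces
   below being finite-dimensional. *)
Fixpoint C_k (R : realType) (V W : normedModType R) (k : nat) (U : set V)
    (f : V -> W) : Prop :=
  match k with
  | 0 => forall x, U x -> {for x, continuous f}
  | k'.+1 => (forall x, U x -> differentiable f x) /\
             (forall v : V, C_k k' U (fun x => 'D_v f x))
  end.

Definition smooth_on (R : realType) (V W : normedModType R) (U : set V)
    (f : V -> W) : Prop := forall k : nat, C_k k U f.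

(* Smooth n-manifolds without boundary, given by an atlas. The carrier is pointed
   because [connected] holds of the empty set. The values of [chart i] outside
   [dom i] and of [chart_inv i] outside [cod i] are irrelevant. [chart_at m] is
   some chart around [m]; it only serves to evaluate at [m] quantities that do
   not depend on the chart. *)
Record smooth_manifold (R : realType) (n : nat) := SmoothManifold {
  points :> ptopologicalType;
  points_hausdorff : hausdorff_space points;
  points_second_countable : @second_countable points;
  chart_index : Type;
  dom : chart_index -> set points;
  cod : chart_index -> set 'rV[R]_n;
  chart : chart_index -> points -> 'rV[R]_n;
  chart_inv : chart_index -> 'rV[R]_n -> points;
  dom_open : forall i, open (dom i);
  cod_open : forall i, open (cod i);
  chart_cod : forall i m, dom i m -> cod i (chart i m);
  chart_inv_dom : forall i x, cod i x -> dom i (chart_inv i x);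
  chartK : forall i m, dom i m -> chart_inv i (chart i m) = m;
  chart_invK : forall i x, cod i x -> chart i (chart_inv i x) = x;
  chart_continuous : forall i m, dom i m -> {for m, continuous (chart i)};
  chart_inv_continuous :
    forall i x, cod i x -> {for x, continuous (chart_inv i)};
  transition_smooth : forall i j,
    smooth_on (cod i `&` chart_inv i @^-1` dom j) (chart j \o chart_inv i);
  chart_at : points -> chart_index;
  chart_at_dom : forall m, dom (chart_at m) m
}.

Definition transition (R : realType) (n : nat) (M : smooth_manifold R n)
    (i j : chart_index M) : 'rV[R]_n -> 'rV[R]_n := chart j \o chart_inv i.

(* An orientation is recorded by restricting the maximal atlas to the
   positively oriented charts. *)
Definition oriented (R : realType) (n : nat) (M : smooth_manifold R n) : Prop :=
  forall (i j : chart_index M) x, cod i x -> dom j (chart_inv i x) ->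
    0 < \det ('J (transition i j) x).

(* [metric_at i x] is the Gram matrix of the coordinate frame of chart [i] at
   the point of coordinates [x]. Row [a] of ['J f x] is the partial derivative
   of [f] along the [a]-th coordinate. *)
Record riemannian_metric (R : realType) (n : nat) (M : smooth_manifold R n) :=
  RiemannianMetric {
    metric_at :> chart_index M -> 'rV[R]_n -> 'M[R]_n;
    metric_smooth : forall i, smooth_on (cod i) (metric_at i);
    metric_sym : forall i x, cod i x -> (metric_at i x)^T = metric_at i x;
    metric_pos : forall i x, cod i x -> forall v : 'rV[R]_n, v != 0 ->
      0 < (v *m metric_at i x *m v^T) 0 0;
    metric_transition : forall i j x, cod i x -> dom j (chart_inv i x) ->
      metric_at i x = 'J (transition i j) x *m
                      metric_at j (transition i j x) *m
                      ('J (transition i j) x)^T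
  }.

Definition smooth_immersion (R : realType) (n d : nat)
    (M : smooth_manifold R n) (phi : M -> 'rV[R]_d) : Prop :=
  forall i : chart_index M,
    smooth_on (cod i) (phi \o chart_inv i) /\
    forall x, cod i x -> row_free ('J (phi \o chart_inv i) x).

Definition isometric (R : realType) (n d : nat) (M : smooth_manifold R n)
    (g : riemannian_metric M) (phi : M -> 'rV[R]_d) : Prop :=
  forall (i : chart_index M) x, cod i x ->
    'J (phi \o chart_inv i) x *m ('J (phi \o chart_inv i) x)^T = g i x.

Section Curvature.
Variables (R : realType) (n : nat) (G : 'rV[R]_n -> 'M[R]_n).
Implicit Types (x u v w : 'rV[R]_n) (i j k l : 'I_n).

Definition partial i (f : 'rV[R]_n -> R) x : R := 'D_(delta_mx 0 i) f x.

(* [christoffel l i j x] is Gamma^l_ij. *)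
Definition christoffel l i j x : R :=
  2^-1 * \sum_m invmx (G x) l m *
    (partial i (fun y => G y j m) x + partial j (fun y => G y i m) x
     - partial m (fun y => G y i j) x).

(* The coefficient on d_l of R(d_i, d_j) d_k, where
   R(X, Y) = [nabla_X, nabla_Y] - nabla_[X, Y]. *)
Definition riemann l i j k x : R :=
  partial i (christoffel l j k) x - partial j (christoffel l i k) x
  + \sum_m (christoffel l i m x * christoffel m j k x
            - christoffel l j m x * christoffel m i k x).

(* Ric(Y, Z) is the trace of X |-> R(X, Y) Z. *)
Definition ricci x : 'M[R]_n := \matrix_(j, k) \sum_i riemann i i j k x.

Definition inner x u v : R := (u *m G x *m v^T) 0 0.

Definition curvature_op x u v w : 'rV[R]_n :=
  \row_l \sum_i \sum_j \sum_k riemann l i j k x * u 0 i * v 0 j * w 0 k.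

Definition sectional x u v : R :=
  inner x (curvature_op x u v v) u /
  (inner x u u * inner x v v - inner x u v ^+ 2).

(* The norm of a 2-tensor: |B|^2 = g^ab g^cd B_ac B_bd. *)
Definition tensor_norm x (B : 'M[R]_n) : R :=
  Num.sqrt (\tr (invmx (G x) *m B *m invmx (G x) *m B^T)).

End Curvature.

Section RiemannianQuantities.
Variables (R : realType) (n : nat) (M : smooth_manifold R n).
Variable g : riemannian_metric M.

Definition coordinates (m : M) : 'rV[R]_n := chart (chart_at m) m.

Definition ricci_deviation (k : R) (m : M) : R :=
  let G := g (chart_at m) in
  let x := coordinates m in
  tensor_norm G x (ricci G x - k *: G x).

Definition ricci_deviation_sup (k : R) : \bar R :=
  ereal_sup (range (fun m : M => (ricci_deviation k m)%:E)).

(* The maximum of |K(P)| over the planes P, each given by a basis (u, v). It is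
   0 in dimension 1, where there is no plane. *)
Definition max_sectional (m : M) : R :=
  sup [set `|sectional (g (chart_at m)) (coordinates m) uv.1 uv.2| |
       uv in [set uv : 'rV[R]_n * 'rV[R]_n | row_free (col_mx uv.1 uv.2)]].

End RiemannianQuantities.

(* Lebesgue integral over R^n of a nonnegative Borel function, computed as an
   iterated integral (Tonelli). *)
Fixpoint integral_rV (R : realType) (n : nat) :
    ('rV[R]_n -> \bar R) -> \bar R :=
  match n return ('rV[R]_n -> \bar R) -> \bar R with
  | 0 => fun f => f 0%R
  | n'.+1 => fun f =>
      \int[@lebesgue_measure R]_t
        integral_rV (fun x : 'rV[R]_n' => f (row_mx (t%:M : 'rV[R]_1) x)%R)
  end%E.

Definition borel (T : ptopologicalType) := g_sigma_algebraType (@open T).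

(* The Riemannian measure is the unique Borel measure given by
   sqrt (det g) dx in every chart. *)
Definition is_riemannian_measure (R : realType) (n : nat)
    (M : smooth_manifold R n) (g : riemannian_metric M)
    (mu : {measure set (borel M) -> \bar R}) : Prop :=
  forall (i : chart_index M) (A : set (borel M)),
    measurable A -> A `<=` dom i ->
    mu A = integral_rV
      (fun x => (Num.sqrt (\det (g i x)) * \1_(chart i @` A) x)%:E).

Definition unit_sphere (R : realType) (n : nat) : set 'rV[R]_n.+1 :=
  [set x | \sum_i x 0 i ^+ 2 = 1].

Definition homeomorphic (T U : topologicalType) : Prop :=
  exists (f : T -> U) (h : U -> T),
    [/\ continuous f, continuous h, cancel f h & cancel h f].

(* Main.v *)
(* By the Gauss equation, Ric = S h - h g^-1 h with h the second fundamental form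
   and S its trace. Once Ric is positive definite, S h(v, v) > |h v|^2 >= 0 for
   v != 0, so h is definite for a suitable unit normal N. Hence eps = k / 2 works
   whatever the value of the norm of K, and what remains is Hadamard's theorem.
   For a unit vector u, a critical point of the height function m |-> <u, phi m>
   is a strict local minimum if u = N and a strict local maximum if u = - N. In
   dimension at least 2 a strict local maximum does not disconnect the sublevel
   sets, so by a mountain-pass argument the strict local minimum is unique.
   Therefore sending u to the lowest point in the direction u is a continuous
   bijection from the sphere to M, inverse to the Gauss map. In dimension 1 the
   Ricci curvature vanishes and the hypothesis cannot hold. *)
Require Import Defs.
From HB Require Import structures.
From mathcomp Require Import all_boot all_order all_algebra.
From mathcomp Require Import all_classical all_reals all_analysis.
From mathcomp Require Import ring lra.
Set Implicit Arguments.
Unset Strict Implicit.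
Unset Printing Implicit Defensive.
Import Order.TTheory GRing.Theory Num.Theory.
Import numFieldNormedType.Exports.
Local Open Scope classical_set_scope.
Local Open Scope ring_scope.

(** * A topological mountain-pass theorem *)

Section MountainPass.
Variables (R : realType) (T : topologicalType).
Implicit Types (f : T -> R) (x y m : T).

(** The mountain-pass argument is purely topological and uses no gradient flow. Of a point that is
    not a strict minimum it asks only that, nearby, the strict sublevel set lies in one connected
    part of itself and accumulates at the level set. Regular points qualify by sliding down a
    direction of increase, strict maxima because a punctured ball is connected in dimension at least
    2. The normal is chosen point by point, by the sign of the second fundamental form, so nothing
    makes it continuous a priori. Continuity is proved for the lowest point as a function of the
    direction, and compactness of the sphere transfers it to the Gauss map. Curvature is defined
    from the metric alone, so the Gauss equation has to be extracted from the Christoffel symbols: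
    the identity between Gamma^l_ij g_lm and the product of d_i d_j F with d_m F is differentiated
    once more, and antisymmetrising removes the third derivatives. The constant k / 2 comes from
    bounding a quadratic form by its Frobenius norm: a deviation of at most k / 2 gives Ric >= (k /
    2) g. *)

Definition strict_local_min f x := \forall y \near x, y <> x -> f x < f y.

(* Raising the level past f x near x does not merge two components of the
   sublevel set. *)
Definition passing_point f x :=
  exists2 N, nbhs x N &
    (exists C, [/\ connected C, C `<=` [set y | f y < f x] &
                   N `&` [set y | f y < f x] `<=` C]) /\
    N `&` [set y | f y = f x] `<=` closure [set y | f y < f x].

Definition locally_connected :=
  forall x N, nbhs x N -> exists C, [/\ connected C, nbhs x C & C `<=` N].

Lemma passing_point_not_min f x :
  passing_point f x -> exists y, f y < f x.
Proof.
move=> [N Nx [_ Ncl]]; have clx := Ncl x (conj (nbhs_singleton Nx) erefl).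
by have [y [/= fy _]] := clx _ Nx; exists y.
Qed.

(** Raise the level until the component of [m1] reaches [m2]. At the infimum [c0] of such levels the
    closed component is isolated in [[set y | f y <= c0]], because neither strict minima nor passing
    points let it touch another piece. Slightly higher sublevel sets are then still split, against
    the choice of [c0]. *)
Lemma unique_strict_local_min f m1 m2 :
    hausdorff_space T -> compact [set: T] -> connected [set: T] ->
    locally_connected -> continuous f ->
    (forall x, strict_local_min f x \/ passing_point f x) ->
  strict_local_min f m1 -> strict_local_min f m2 -> m1 = m2.
Proof.
move=> hT cT coT lcT cf fP min1 min2; apply: contrapT => m12.
pose L c := [set y | f y < c].
have oL c : open (L c).
  apply: (@open_comp _ _ f [set y | y < c]) => [x _|]; [exact: cf|exact: open_lt].
pose U c := connected_component (L c) m1.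
have Ugt c y : U c y -> f m1 < c.
  move=> Ucy; rewrite ltNge; apply/negP => cm.
  move: Ucy; rewrite /U connected_component_out //=.
  by apply/negP; rewrite -leNgt.
have UL c : U c `<=` L c by exact: connected_component_sub.
have Uid c : f m1 < c -> U c m1 by move=> ?; exact: connected_component_refl.
have Umax c C y : U c y -> C y -> connected C -> C `<=` L c -> C `<=` U c.
  move=> Uy Cy coC CL; apply: subset_trans (connected_component_max Cy CL coC) _.
  by move=> z; exact: connected_component_trans.
have UC c c' : c <= c' -> U c `<=` U c'.
  move=> cc' y Uy; have mc := Ugt _ _ Uy.
  apply: (connected_component_max (Uid _ mc) _ _ Uy).
    by move=> w /UL Lw; exact: lt_le_trans Lw cc'.
  exact: component_connected.
have loc c y : L c y -> exists C, [/\ connected C, nbhs y C & C `<=` L c].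
  by move=> Ly; apply: lcT; exact: open_nbhs_nbhs.
have oU c : open (U c).
  rewrite openE => y Uy; have [C [coC yC CL]] := loc _ _ (UL _ _ Uy).
  apply: (filterS _ yC); exact: (Umax _ _ _ Uy (nbhs_singleton yC) coC CL).
have U_clos c y : closure (U c) y -> f y < c -> U c y.
  move=> cly yc; have [C [coC yC CL]] := loc _ _ yc.
  have [z [Uz Cz]] := cly _ yC.
  exact: (Umax _ _ _ Uz Cz coC CL _ (nbhs_singleton yC)).
pose E := [set c | U c m2].
have E0 : E !=set0.
  have [|//||c _ fc] := @compact_EVT_max T R f setT; first by exists m1.
    exact: continuous_subspaceT.
  exists (f c + 1); rewrite /E /=.
  have LT : L (f c + 1) = setT.
    apply/seteqP; split => // y _; rewrite /L /=.
    by rewrite (le_lt_trans (fc y _)) ?inE // ltrDl.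
  by rewrite /U LT connected_component_id.
have lbE : lbound E (f m1) by move=> c /Ugt /ltW.
have hiE : has_inf E by split => //; exists (f m1).
(* The mountain-pass level between m1 and m2. *)
pose c0 := inf E.
have m1c0 : f m1 <= c0 by exact: lb_le_inf.
have Ec0 c : c0 < c -> exists2 e, E e & e < c by move=> ?; exact: inf_lt.
(* The infimum is not attained: the union [V] of the lower components is open and closed in [U c0],
   hence equal to it, so [m2] would already be reached at some [c < c0]. *)
have nU : ~ U c0 m2.
  move=> Um2; have m1c := Ugt _ _ Um2.
  pose V := \bigcup_(c in [set c | f m1 < c /\ c < c0]) U c.
  have [e me ec] : exists2 e, f m1 < e & e < c0.
    by exists ((f m1 + c0) / 2); lra.
  have Vm1 : V m1 by exists e => //; exact: Uid.
  have VU : V `<=` U c0.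
    by move=> y [c [mc cc]]; exact: UC (ltW cc) _.
  have VE : V = U c0.
    apply: (component_connected (A := L c0) (x := m1)) => //; first by exists m1.
    - exists V; last by rewrite [RHS]setIidr.
      by apply: bigcup_open => c _.
    - exists (closure V); first exact: closed_closure.
      apply/seteqP; split => y; first by move=> Vy; split; [exact: VU|exact: subset_closure].
      move=> [Uy Vy]; have yc : f y < c0 := UL _ _ Uy.
      pose c := Num.max ((f y + c0) / 2) e.
      have fyc : f y < c by rewrite lt_max; apply/orP; left; lra.
      have cc : c < c0 by rewrite gt_max ec andbT; lra.
      have [C [coC yC CL]] := loc _ _ fyc.
      have [z [[d [md dc] Uz] Cz]] := Vy _ yC.
      exists (Num.max c d) => /=; first by rewrite lt_max md orbT gt_max cc.
      have mcd : f m1 < Num.max c d by rewrite lt_max md orbT.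
      have Uz' : U (Num.max c d) z by apply: UC Uz => //; rewrite le_max lexx orbT.
      apply: (Umax _ _ _ Uz' Cz coC _ _ (nbhs_singleton yC)).
      by move=> w /CL /= wc; rewrite /L /= lt_max wc.
  have : V m2 by rewrite VE.
  move=> [c [_ cc] Uc].
  have : c0 <= c by apply: ge_inf => //; exists (f m1).
  by rewrite leNgt cc.
pose G := [set y | f y <= c0].
(* The point [m1] is added because [U c0] is empty when [c0 = f m1]. *)
pose K := closure (U c0) `|` [set m1].
have clG : closed G.
  apply: (@closed_comp _ _ f [set y | y <= c0]) => [y _|]; [exact: cf|exact: closed_le].
have clK : closed K.
  apply: closedU; first exact: closed_closure.
  by apply: accessible_closed_set1; exact: hausdorff_accessible.
have KG : K `<=` G.
  move=> y [|->//]; rewrite (closure_id G).1 //; apply: closureS.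
  by move=> z /UL /ltW.
(* K is relatively open in G, so it can be separated from the rest of G. *)
have nbK x : K x -> exists2 N, nbhs x N & N `&` G `<=` K.
  move=> Kx; have := KG _ Kx; rewrite /G /= le_eqVlt => /orP[/eqP fx|fx].
    (* On the level [c0], a strict minimum is isolated in [G]. At a passing point in the closure of
       [U c0], the set [C] meets [U c0], hence lies in it, and nearby level points are limits of
       points of [C]. *)
    case: (fP x) => [mx|[N Nx [[C [coC CL NC]] Ncl]]].
      exists (fun y => y <> x -> f x < f y) => // y [yx Gy].
      have [->//|/eqP] := eqVneq y x; move=> /yx; rewrite fx ltNge.
      by move: Gy; rewrite /G /= => ->.
    case: Kx => [Kx|xm].
      rewrite fx in NC CL Ncl.
      have [z [Uz Nz]] := Kx _ Nx.
      have CU : C `<=` U c0 by apply: (Umax _ _ z) => //; apply: NC; split => //; exact: UL.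
      exists N°; first exact: nbhs_interior.
      move=> y [Ny]; rewrite /G /= le_eqVlt => /orP[/eqP fy|fy]; left; last first.
        by apply/subset_closure/CU/NC; split => //; exact: nbhs_singleton.
      move=> W yW; have cly := Ncl y (conj (nbhs_singleton Ny) fy).
      have [w [/= wc [Ww Nw]]] := cly _ (filterI yW Ny).
      by exists w; split => //; apply: CU; apply: NC.
    exists (fun y => y <> m1 -> f m1 < f y); first by rewrite xm.
    move=> y [ym Gy]; right; apply: contrapT => /ym.
    by rewrite -xm fx ltNge; move: Gy; rewrite /G /= => ->.
  exists (U c0); last by move=> y [Uy _]; left; exact: subset_closure.
  apply: open_nbhs_nbhs; split; first exact: oU.
  case: Kx => [/U_clos|xm]; first exact.
  by rewrite xm; apply: Uid; rewrite -xm.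
(* A strict minimum on the level [c0] is not a limit of points of lower level. *)
have nK : ~ K m2.
  move=> [clm|m21]; last by apply: m12; rewrite m21.
  have := KG _ (or_introl clm); rewrite /G /= le_eqVlt => /orP[/eqP fx|fx].
    have [y [Uy]] := clm _ min2; move/UL: Uy; rewrite /L /= -fx => Uy ym.
    have ym2 : y <> m2 by move=> e; rewrite e ltxx in Uy.
    by have := lt_trans Uy (ym ym2); rewrite ltxx.
  exact/nU/U_clos.
pose B := G `\` K.
have clB : closed B.
  move=> y cly; have Gy : G y.
    by rewrite (closure_id G).1 //; apply: closureS cly => z [].
  split => // /nbK [N yN NK]; have [z [[Gz nKz] Nz]] := cly _ yN.
  by apply: nKz; apply: NK.
have [V [V' [oV oV' KV BV' VV']]] : exists V V' : set T,
    [/\ open V, open V', K `<=` V, B `<=` V' & V `&` V' = set0].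
  apply: (@normal_openP R T).1 => //; first exact: compact_normal.
  by apply/seteqP; split => // y [Ky [_]].
(* Outside [V] and [V'] the function exceeds [c0]; by compactness its minimum there serves as
   [c1]. *)
have [c1 c01 c1P] : exists2 c1, c0 < c1 & L c1 `<=` V `|` V'.
  have clZ : closed (~` (V `|` V')) by rewrite closedC; exact: openU.
  have cZ : compact (~` (V `|` V')) by exact: subclosed_compact cT _.
  have [Z0|/nonemptyPn Z0] := pselect ((~` (V `|` V')) !=set0); last first.
    exists (c0 + 1); first by rewrite ltrDl.
    move=> y _; apply: contrapT => ny.
    by have : (~` (V `|` V')) y by []; rewrite Z0.
  have [|z Zz zP] := compact_EVT_min Z0 cZ (f := f); first exact: continuous_subspaceT.
  exists (f z).
    rewrite ltNge; apply/negP => Gz; move: Zz; rewrite inE; apply.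
    have [Kz|nKz] := pselect (K z); first by left; exact: KV.
    by right; apply: BV'.
  move=> y /= yz; apply: contrapT => ny.
  by have := zP y; rewrite inE leNgt yz => /(_ ny).
have sV : separated V V'.
  split; apply/seteqP; split => // y [].
    by move=> cly V'y; have [] := cly V'; [exact: open_nbhs_nbhs|rewrite VV'; move=> ? []].
  by move=> Vy cly; have [] := cly V; [exact: open_nbhs_nbhs|rewrite setIC VV'; move=> ? []].
have VU c : c < c1 -> f m1 < c -> U c `<=` V.
  move=> cc1 mc; have coU : connected (U c) by exact: component_connected.
  have [|UV|UV] := connected_subset sV _ coU.
  - apply: subset_trans (@UL c) _; apply: subset_trans c1P => y /= /lt_trans; exact.
  - exact: UV.
  - have : (V `&` V') m1; last by rewrite VV'.
    by split; [apply: KV; right|apply/UV/Uid].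
(* Some level [e] of [E] lies just above [c0]. If [m2] is in [G], it is in [V'] although [U e] stays
   in [V]; if [f m2 > c0], then [e] can be taken below [f m2], too low to contain [m2]. *)
have [Gm2|] := boolP (f m2 <= c0).
  have [e Ee ec] := Ec0 _ c01.
  have : (V `&` V') m2; last by rewrite VV'.
  by split; [apply: (VU e) => //; exact: Ugt Ee|exact: BV'].
rewrite -ltNge => c0m.
have [e Ee ec] := Ec0 _ c0m.
by have := UL _ _ Ee; rewrite /L /= ltNge (ltW ec).
Qed.

End MountainPass.

(** * The Euclidean inner product on row vectors *)

Definition dotp (R : realType) (n : nat) (u v : 'rV[R]_n) : R :=
  \sum_i u 0 i * v 0 i.

Section DotProduct.
Variables (R : realType) (n : nat).
Implicit Types (u v w : 'rV[R]_n).

Lemma dotpC u v : dotp u v = dotp v u.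
Proof. by apply: eq_bigr => i _; rewrite mulrC. Qed.

Lemma dotpE u v : dotp u v = (u *m v^T) 0 0.
Proof. by rewrite !mxE; apply: eq_bigr => i _; rewrite mxE. Qed.

Lemma dotpDl u v w : dotp (u + v) w = dotp u w + dotp v w.
Proof. by rewrite !dotpE mulmxDl mxE. Qed.

Lemma dotpZl a u v : dotp (a *: u) v = a * dotp u v.
Proof. by rewrite !dotpE -scalemxAl mxE. Qed.

Lemma dotpNl u v : dotp (- u) v = - dotp u v.
Proof. by rewrite -scaleN1r dotpZl mulN1r. Qed.

Lemma dotpBl u v w : dotp (u - v) w = dotp u w - dotp v w.
Proof. by rewrite dotpDl dotpNl. Qed.

Lemma dotpZr a u v : dotp u (a *: v) = a * dotp u v.
Proof. by rewrite !(dotpC u) dotpZl. Qed.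

Lemma dotpNr u v : dotp u (- v) = - dotp u v.
Proof. by rewrite !(dotpC u) dotpNl. Qed.

Lemma dotpBr u v w : dotp u (v - w) = dotp u v - dotp u w.
Proof. by rewrite !(dotpC u) dotpBl. Qed.

Lemma dotp0l u : dotp 0 u = 0.
Proof. by rewrite dotpE mul0mx mxE. Qed.

Lemma dotp_suml (I : finType) (F : I -> 'rV[R]_n) v :
  dotp (\sum_i F i) v = \sum_i dotp (F i) v.
Proof.
apply: (big_morph (fun u => dotp u v)); last exact: dotp0l.
by move=> u w; exact: dotpDl.
Qed.

Lemma dotp_ge0 u : 0 <= dotp u u.
Proof. by apply: sumr_ge0 => i _; rewrite -expr2 sqr_ge0. Qed.

Lemma dotp_eq0 u : dotp u u = 0 -> u = 0.
Proof.
move=> /eqP; rewrite psumr_eq0; last by move=> i _; rewrite -expr2 sqr_ge0.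
move=> /allP u0; apply/rowP => i; rewrite mxE.
by have := u0 i (mem_index_enum _); rewrite mulf_eq0 orbb => /eqP.
Qed.

Lemma coord_le_norm u i : `|u 0 i| <= `|u|.
Proof.
rewrite [leRHS]/Num.Def.normr/= mx_normrE.
exact: (le_bigmax _ (fun ij => `|u ij.1 ij.2|) (0, i)).
Qed.

Lemma norm_le_coord u e : 0 <= e -> (forall i, `|u 0 i| <= e) -> `|u| <= e.
Proof.
move=> e0 ue; rewrite [leLHS]/Num.Def.normr/= mx_normrE.
by apply: bigmax_le => // -[a i] _ /=; rewrite ord1.
Qed.

(** The norm of row vectors is the sup norm, hence the factor [n] instead of the Cauchy-Schwarz
    inequality. *)
Lemma dotp_le_norm u v : `|dotp u v| <= n%:R * (`|u| * `|v|).
Proof.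
apply: le_trans (ler_norm_sum _ _ _) _.
apply: (@le_trans _ _ (\sum_(i < n) `|u| * `|v|)).
  by apply: ler_sum => i _; rewrite normrM ler_pM // coord_le_norm.
by rewrite sumr_const card_ord mulr_natl.
Qed.

End DotProduct.

Lemma cvg_sumr (R : realType) (T I : Type) (F : set_system T) (s : seq I)
    (f : I -> T -> R) (a : I -> R) {FF : Filter F} :
  (forall i, f i x @[x --> F] --> a i) ->
  (\sum_(i <- s) f i x) @[x --> F] --> \sum_(i <- s) a i.
Proof.
move=> fa; elim: s => [|i s IH].
  rewrite big_nil; under eq_cvg do rewrite big_nil; exact: cvg_cst.
by rewrite big_cons; under eq_cvg do rewrite big_cons; exact: cvgD.
Qed.

Lemma cvg_coord (R : realType) (n : nat) (T : Type) (F : set_system T)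
    (f : T -> 'rV[R]_n) (a : 'rV[R]_n) i {FF : Filter F} :
  f x @[x --> F] --> a -> f x 0 i @[x --> F] --> a 0 i.
Proof.
move=> fa; apply: (@cvg_comp _ _ _ f (fun M : 'rV[R]_n => M 0 i) _ _ _ fa).
exact: coord_continuous.
Qed.

Lemma cvg_dotp (R : realType) (n : nat) (T : Type) (F : set_system T)
    (f g : T -> 'rV[R]_n) (a b : 'rV[R]_n) {FF : Filter F} :
  f x @[x --> F] --> a -> g x @[x --> F] --> b ->
  dotp (f x) (g x) @[x --> F] --> dotp a b.
Proof.
by move=> fa gb; apply: cvg_sumr => i; apply: cvgM; exact: cvg_coord.
Qed.

Lemma dotp1_coord_le (R : realType) (n : nat) (u : 'rV[R]_n) i :
  dotp u u = 1 -> `|u 0 i| <= 1.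
Proof.
move=> u1; rewrite -[leRHS]sqrtr1 -sqrtr_sqr ler_wsqrtr // -u1 /dotp.
by rewrite (bigD1 i) //= -expr2 lerDl sumr_ge0 // => j _; rewrite -expr2 sqr_ge0.
Qed.

Lemma compact_dotp1 (R : realType) (n : nat) :
  compact [set u : 'rV[R]_n | dotp u u = 1].
Proof.
apply: bounded_closed_compact.
  exists 1; split => // M M1 u u1; apply: (le_trans _ (ltW M1)).
  by apply: norm_le_coord => // i; exact: dotp1_coord_le.
rewrite (_ : mkset _ = (fun u : 'rV[R]_n => dotp u u) @^-1` [set x | x = 1]) //.
apply: closed_comp; last exact: closed_eq.
by move=> u _; apply: (@cvg_dotp _ _ _ (nbhs u) id id); exact: cvg_id.
Qed.

(** * Lowest points and the homeomorphism with the sphere *)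

Section GaussMap.
Variables (R : realType) (n : nat) (T : ptopologicalType).
Variable phi : T -> 'rV[R]_n.+1.

Let S := @unit_sphere R n.

Definition lowest_at (u : 'rV[R]_n.+1) m :=
  forall y, dotp u (phi m) <= dotp u (phi y).

Hypothesis hT : hausdorff_space T.
Hypothesis cT : compact [set: T].
Hypothesis cphi : continuous phi.
Hypothesis lowest_unique :
  forall u m m', S u -> lowest_at u m -> lowest_at u m' -> m = m'.
Hypothesis lowest_exists : forall m, exists2 u, S u & lowest_at u m.
Hypothesis normal_unique :
  forall u u' m, S u -> S u' -> lowest_at u m -> lowest_at u' m -> u = u'.

Lemma height_continuous u : continuous (fun m => dotp u (phi m)).
Proof. by move=> m; apply: cvg_dotp; [exact: cvg_cst|exact: (@cphi m)]. Qed.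

Lemma lowest_point u : {m | lowest_at u m}.
Proof.
apply: cid; have [|//||m _ mP] := @compact_EVT_min T R (fun m => dotp u (phi m)) setT.
- by exists point.
- exact/continuous_subspaceT/height_continuous.
- by exists m => y; apply: mP; rewrite inE.
Qed.

Let sigma u := sval (lowest_point u).

Let sigmaP u : lowest_at u (sigma u).
Proof. exact: svalP. Qed.

Lemma phi_bounded : exists2 B, 0 < B & forall m, `|phi m| < B.
Proof.
have /compact_bounded /ex_strict_bound_gt0 [B B0 BP] : compact (range phi).
  by apply: continuous_compact => //; exact: continuous_subspaceT.
by exists B => // m; apply: BP; exists m.
Qed.

(** Off a neighbourhood of [sigma u] the height exceeds its minimum by a gap [d]. Tilting [u] so
    little that all heights change by at most [d / 3] leaves the lowest point inside the
    neighbourhood. *)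
Let sigma_continuous : {within S, continuous sigma}.
Proof.
apply/subspace_continuousP => u Su W /=; rewrite nbhsE => -[N [oN Nm] NW].
have [B B0 BP] := phi_bounded.
have [d d0 dP] : exists2 d, 0 < d &
    forall y, ~ N y -> dotp u (phi (sigma u)) + d <= dotp u (phi y).
  have [Z0|/nonemptyPn Z0] := pselect ((~` N) !=set0); last first.
    by exists 1 => // y ny; have : (~` N) y by []; rewrite Z0.
  have cZ : compact (~` N).
    by apply: subclosed_compact cT _ => //; exact: open_closedC.
  have [|z zN zP] := compact_EVT_min Z0 cZ (f := fun m => dotp u (phi m)).
    exact/continuous_subspaceT/height_continuous.
  exists (dotp u (phi z) - dotp u (phi (sigma u))); last first.
    by move=> y ny; rewrite addrC subrK; apply: zP; rewrite inE.
  rewrite subr_gt0 lt_neqAle sigmaP andbT; apply/negP => /eqP uz.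
  move: zN; rewrite inE /=; apply.
  rewrite -(@lowest_unique u (sigma u) z) // => y.
  by rewrite -uz; exact: sigmaP.
(* By [dotp_le_norm] and the bound [B] on [phi], moving [u] by [e] changes heights by at most
   [d / 3]. *)
pose e := d / 3 / (n.+1%:R * B).
have e0 : 0 < e by rewrite !divr_gt0 // mulr_gt0.
change (\forall u' \near u, S u' -> W (sigma u')); near=> u' => _; apply: NW.
have u'e : `|u' - u| <= e.
  by rewrite distrC; near: u'; exact: (@cvgr_dist_le _ _ _ _ _ id u).
have close y : `|dotp u' (phi y) - dotp u (phi y)| <= d / 3.
  rewrite -dotpBl; apply: le_trans (dotp_le_norm _ _) _.
  rewrite (_ : d / 3 = n.+1%:R * (e * B)); last first.
    by rewrite /e mulrCA divfK // mulf_neq0 // gt_eqF.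
  by rewrite ler_wpM2l // ler_pM // ltW.
apply: contrapT => /dP.
have := sigmaP u' (sigma u).
have := close (sigma u); have := close (sigma u').
rewrite !ler_norml => /andP[? ?] /andP[? ?] ? ?.
lra.
Unshelve. all: by end_near. Qed.

Let sphere_compact : compact S.
Proof.
rewrite (_ : S = [set u | dotp u u = 1]); first exact: compact_dotp1.
by rewrite /S /unit_sphere; apply/seteqP; split => u /= <-;
  apply: eq_bigr => i _; rewrite expr2.
Qed.

Lemma homeomorphic_sphere : homeomorphic T (set_type S).
Proof.
have nuP m : {u : set_type S | lowest_at (set_val u) m}.
  apply: cid; have [u Su um] := lowest_exists m.
  by exists (exist _ u (mem_set Su)); rewrite set_valE.
have Sval (u : set_type S) : S (set_val u) by rewrite set_valE; exact/set_mem/valP.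
pose nu m := sval (nuP m).
have nuK m : sigma (set_val (nu m)) = m.
  exact: (lowest_unique (Sval (nu m)) (sigmaP _) (svalP (nuP m))).
exists nu, (sigL S sigma); split.
- apply: (@continuous_comp_initial (set_type S)).
  apply/continuous_closedP => A clA.
  (* The preimage of [A] under the Gauss map is the image under [sigma] of a compact set, hence
     closed. *)
  rewrite (_ : _ @^-1` A = sigma @` (A `&` S)); last first.
    apply/seteqP; split => [m Am|m [u [Au Su] <-]].
      by exists (set_val (nu m)).
    rewrite /preimage /= (_ : set_val _ = u) //.
    apply: (@normal_unique _ _ (sigma u)) => //.
    by rewrite -{2}(nuK (sigma u)).
  apply: compact_closed => //; apply: continuous_compact.
    by apply: continuous_subspaceW sigma_continuous => u [].
  by rewrite setIC; exact: compact_closedI sphere_compact clA.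
- exact/subspace_sigL_continuousP.
- exact: nuK.
- move=> u; apply: val_inj.
  exact: (normal_unique (Sval (nu _)) (Sval u) (svalP (nuP _)) (sigmaP _)).
Qed.

End GaussMap.

(** * Mean values along lines and symmetry of second derivatives *)

Section Lines.
Variables (R : realType) (V : normedModType R).
Implicit Types (a x y v w : V).

Lemma nbhs_norm x (N : set V) :
  nbhs x N -> exists2 r, 0 < r & forall y, `|y - x| < r -> N y.
Proof.
move=> /nbhs_ballP[r r0]; rewrite -ball_normE => rN; exists r => // y yr.
by apply: rN; rewrite /= distrC.
Qed.

Lemma norm_nbhs x (N : set V) r :
  0 < r -> (forall y, `|y - x| < r -> N y) -> nbhs x N.
Proof.
move=> r0 rN; apply/nbhs_ballP; exists r => // y.
by rewrite -ball_normE /= distrC; exact: rN.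
Qed.

Lemma is_derive_line (W : normedModType R) (g : V -> W) a v t l :
  is_derive (a + t *: v) v g l -> is_derive t 1 (fun s => g (a + s *: v)) l.
Proof.
move=> [dg gl].
have E : (fun h : R => h^-1 *: (((fun s => g (a + s *: v)) \o shift t) (h *: 1)
             - g (a + t *: v)))
       = (fun h => h^-1 *: ((g \o shift (a + t *: v)) (h *: v) - g (a + t *: v))).
  apply/funext => h /=; congr (_ *: (g _ - _)).
  by rewrite [h *: 1]mulr1 scalerDl addrCA.
by split; rewrite /derivable /derive E.
Qed.

Lemma MVT_line (g gv : V -> R) a v T : 0 < T ->
    (forall s, 0 <= s <= T -> is_derive (a + s *: v) v g (gv (a + s *: v))) ->
  exists2 c, 0 < c < T & g (a + T *: v) - g a = T * gv (a + c *: v).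
Proof.
move=> T0 dg.
have dg' s : 0 <= s <= T -> is_derive s 1 (fun s => g (a + s *: v)) (gv (a + s *: v)).
  by move=> sT; apply: is_derive_line; exact: dg.
have [||c cT] := @MVT R (fun s => g (a + s *: v)) (fun s => gv (a + s *: v)) 0 T T0.
- by move=> s; rewrite in_itv /= => /andP[s0 sT]; apply: dg'; rewrite !ltW.
- apply: derivable_within_continuous => s; rewrite in_itv /= => sT.
  by have [] := dg' _ sT.
rewrite scale0r addr0 subr0 => ->; exists c; last by rewrite mulrC.
by move: cT; rewrite in_itv.
Qed.

Lemma second_difference (g gv gvw : V -> R) x v w r t :
    (forall y, `|y - x| < r -> is_derive y v g (gv y)) ->
    (forall y, `|y - x| < r -> is_derive y w gv (gvw y)) ->
    0 < t -> t * (`|v| + `|w|) < r ->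
  exists2 y, `|y - x| < r &
    g (x + t *: v + t *: w) - g (x + t *: v) - (g (x + t *: w) - g x) =
    t * (t * gvw y).
Proof.
move=> dg dgv t0 tr.
have inr s s' : 0 <= s <= t -> 0 <= s' <= t -> `|x + s *: v + s' *: w - x| < r.
  move=> /andP[s0 st] /andP[s'0 s't]; apply: le_lt_trans tr.
  rewrite -(addrA x) addrAC subrr add0r; apply: le_trans (ler_normD _ _) _.
  by rewrite !normrZ !ger0_norm // mulrDr lerD // ler_wpM2r.
have tt : 0 <= t <= t by rewrite lexx ltW.
have zt : 0 <= (0 : R) <= t by rewrite lexx ltW.
pose h s := g (x + t *: w + s *: v) - g (x + s *: v).
have dh s : 0 <= s <= t ->
    is_derive s 1 h (gv (x + t *: w + s *: v) - gv (x + s *: v)).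
  move=> st; apply: is_deriveB; apply: is_derive_line; apply: dg.
    by rewrite (addrAC x); exact: inr.
  by rewrite -[x + _]addr0 -(scale0r w); exact: inr.
have [||c cT hc] := @MVT R h (fun s => gv (x + t *: w + s *: v) - gv (x + s *: v)) 0 t t0.
- by move=> s; rewrite in_itv /= => /andP[s0 st]; apply: dh; rewrite !ltW.
- apply: derivable_within_continuous => s; rewrite in_itv /= => sT.
  by have [] := dh _ sT.
have {}cT : 0 <= c <= t by move: cT; rewrite in_itv /= => /andP[? ?]; rewrite !ltW.
have [s st|d dt gd] := @MVT_line gv gvw (x + c *: v) w t t0; first exact/dgv/inr.
exists (x + c *: v + d *: w); first by apply: inr => //; rewrite !ltW; case/andP: dt.
rewrite -gd (addrAC x) (addrAC x _ (t *: w)) mulrC.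
by move: hc; rewrite /h !scale0r !addr0 subr0 opprB addrA.
Qed.

(** The second difference over a small parallelogram is symmetric in [v] and [w]. It is therefore
    the same multiple of a value of [gvw] and of a value of [gwv], both taken near [x], where
    continuity applies. *)
Lemma schwarz (g gv gw gvw gwv : V -> R) x v w :
    (\forall y \near x, is_derive y v g (gv y)) ->
    (\forall y \near x, is_derive y w g (gw y)) ->
    (\forall y \near x, is_derive y w gv (gvw y)) ->
    (\forall y \near x, is_derive y v gw (gwv y)) ->
    {for x, continuous gvw} -> {for x, continuous gwv} ->
  gvw x = gwv x.
Proof.
move=> dgv dgw dgvw dgwv cvw cwv; apply/eqP; rewrite -subr_eq0 -normr_le0.
apply/ler_addgt0Pr => e e0; rewrite add0r.
have e20 : 0 < e / 2 by rewrite divr_gt0.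
have /cvgrPdist_le /(_ _ e20) near_vw := cvw.
have /cvgrPdist_le /(_ _ e20) near_wv := cwv.
have /nbhs_norm[r r0 rP] : \forall y \near x,
    ((is_derive y v g (gv y) /\ is_derive y w g (gw y)) /\
     (is_derive y w gv (gvw y) /\ is_derive y v gw (gwv y))) /\
    (`|gvw x - gvw y| <= e / 2 /\ `|gwv x - gwv y| <= e / 2).
  by do !apply: filterI.
(* The parallelogram stays within [r] of [x]; the [+ 1] covers the case where [v] and [w] vanish. *)
pose t := r / 2 / (`|v| + `|w| + 1).
have vw0 : 0 < `|v| + `|w| + 1 by rewrite ltr_wpDl // addr_ge0.
have t0 : 0 < t by rewrite !divr_gt0.
have tr : t * (`|v| + `|w|) < r.
  rewrite /t mulrAC ltr_pdivrMr //.
  have : 0 <= `|v| + `|w| by rewrite addr_ge0.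
  by move: (`|v| + `|w|) => q q0; nra.
have [||y yr Ey] := @second_difference g gv gvw x v w r t _ _ t0 tr.
- by move=> z /rP [[[? ?] [? ?]] ?].
- by move=> z /rP [[[? ?] [? ?]] ?].
rewrite addrC in tr; have [||z zr Ez] := @second_difference g gw gwv x w v r t _ _ t0 tr.
- by move=> z' /rP [[[? ?] [? ?]] ?].
- by move=> z' /rP [[[? ?] [? ?]] ?].
have Eyz : gvw y = gwv z.
  apply: (mulfI (lt0r_neq0 t0)); apply: (mulfI (lt0r_neq0 t0)).
  by rewrite -Ey -Ez (addrAC x); ring.
have [_ [vwy _]] := rP _ yr; have [_ [_ wvz]] := rP _ zr.
move: vwy wvz; rewrite Eyz !ler_norml => /andP[? ?] /andP[? ?].
by apply/andP; split; lra.
Qed.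
End Lines.

(** * Derivatives of smooth vector-valued maps *)

Section Smooth.
Variables (R : realType) (n d : nat) (U : set 'rV[R]_n).
Implicit Types (F : 'rV[R]_n -> 'rV[R]_d) (x v w : 'rV[R]_n).

Lemma smooth_differentiable F x : smooth_on U F -> U x -> differentiable F x.
Proof. by move=> /(_ 1%N) [+ _]; exact. Qed.

Lemma smooth_derive F v : smooth_on U F -> smooth_on U ('D_v F).
Proof. by move=> sF k; have [_] := sF k.+1; exact. Qed.

Lemma smooth_continuous F x : smooth_on U F -> U x -> {for x, continuous F}.
Proof. by move=> /(_ 0%N) /=; exact. Qed.

Lemma smooth_is_derive F v x :
  smooth_on U F -> U x -> is_derive x v F ('D_v F x).
Proof.
by move=> sF Ux; apply/derivableP/diff_derivable; exact: smooth_differentiable.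
Qed.

End Smooth.

Section DotDerive.
Variables (R : realType) (V : normedModType R) (d : nat).
Implicit Types (f g : V -> 'rV[R]_d) (x v : V).

Lemma is_derive_coord f x v df i :
  is_derive x v f df -> is_derive x v (fun y => f y 0 i) (df 0 i).
Proof.
move=> [dfx <-]; split; first by move/derivable_mxP : dfx.
by rewrite derive_mx // mxE.
Qed.

Lemma is_derive_sumr (I : Type) (s : seq I) (W : normedModType R)
    (h : I -> V -> W) x v (dh : I -> W) :
  (forall i, is_derive x v (h i) (dh i)) ->
  is_derive x v (fun y => \sum_(i <- s) h i y) (\sum_(i <- s) dh i).
Proof.
move=> dhi; elim: s => [|i s IH].
  rewrite big_nil (_ : (fun _ => _) = cst 0); first exact: is_derive_cst.
  by apply/funext => y; rewrite big_nil.
rewrite big_cons (_ : (fun _ => _) = h i + (fun y => \sum_(j <- s) h j y)).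
  exact: is_deriveD.
by apply/funext => y; rewrite big_cons.
Qed.

Lemma is_derive_dotp f g x v df dg :
  is_derive x v f df -> is_derive x v g dg ->
  is_derive x v (fun y => dotp (f y) (g y)) (dotp df (g x) + dotp (f x) dg).
Proof.
move=> Df Dg; rewrite /dotp -big_split /=; apply: is_derive_sumr => i.
have Dfi := is_derive_coord i Df; have Dgi := is_derive_coord i Dg.
apply: (is_derive_eq (is_deriveM Dfi Dgi)).
by rewrite /GRing.scale /= addrC (mulrC (g x 0 i)).
Qed.

Lemma is_derive_dotpr u f x v df :
  is_derive x v f df -> is_derive x v (fun y => dotp u (f y)) (dotp u df).
Proof.
move=> Df; apply: (is_derive_eq (is_derive_dotp (is_derive_cst u x v) Df)).
by rewrite dotp0l add0r.
Qed.

End DotDerive.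

Section SmoothPartial.
Variables (R : realType) (n d : nat) (U : set 'rV[R]_n).
Hypothesis oU : open U.
Implicit Types (F : 'rV[R]_n -> 'rV[R]_d) (x v w : 'rV[R]_n).

Lemma near_open x (P : 'rV[R]_n -> Prop) :
  U x -> (forall y, U y -> P y) -> \forall y \near x, P y.
Proof. by move=> Ux UP; apply: filterS UP _; exact: open_nbhs_nbhs. Qed.

Lemma deriveC F v w x : smooth_on U F -> U x ->
  'D_v ('D_w F) x = 'D_w ('D_v F) x.
Proof.
move=> sF Ux; apply/rowP => i.
have D v' (G : 'rV[R]_n -> 'rV[R]_d) y : smooth_on U G -> U y ->
    is_derive y v' (fun z => G z 0 i) ('D_v' G y 0 i).
  by move=> sG Uy; apply: is_derive_coord; exact: smooth_is_derive.
have C (G : 'rV[R]_n -> 'rV[R]_d) : smooth_on U G ->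
    {for x, continuous (fun z => G z 0 i)}.
  move=> sG; exact: (cvg_coord (smooth_continuous sG Ux)).
apply: (@schwarz R _ (fun y => F y 0 i) (fun y => 'D_w F y 0 i)
    (fun y => 'D_v F y 0 i) (fun y => 'D_v ('D_w F) y 0 i)
    (fun y => 'D_w ('D_v F) y 0 i) x w v).
- by apply: near_open Ux _ => y; exact: D.
- by apply: near_open Ux _ => y; exact: D.
- by apply: near_open Ux _ => y; apply: D; exact: smooth_derive.
- by apply: near_open Ux _ => y; apply: D; exact: smooth_derive.
- by apply/C/smooth_derive/smooth_derive.
- by apply/C/smooth_derive/smooth_derive.
Qed.

Lemma derive_coordE F v x : differentiable F x ->
  'D_v F x = \sum_i v 0 i *: 'D_(delta_mx 0 i) F x.
Proof.
move=> dF; rewrite deriveE // {1}(row_sum_delta v) linear_sum.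
by apply: eq_bigr => i _; rewrite linearZ deriveE.
Qed.

End SmoothPartial.

(** * Positive definite forms *)

Section PositiveDefinite.
Variables (R : realType) (n : nat).
Implicit Types (A : 'M[R]_n) (v : 'rV[R]_n).

Definition quad A v : R := \sum_i \sum_j v 0 i * v 0 j * A i j.

Lemma quadE A v : quad A v = (v *m A *m v^T) 0 0.
Proof.
rewrite mxE /quad exchange_big; apply: eq_bigr => j _; rewrite !mxE mulr_suml.
by apply: eq_bigr => i _; rewrite mulrAC.
Qed.

Lemma quadZ A a v : quad A (a *: v) = a ^+ 2 * quad A v.
Proof. by rewrite !quadE linearZ /= -!scalemxAl -scalemxAr !mxE mulrA expr2. Qed.

Definition posdef A := forall v, v != 0 -> 0 < quad A v.

(** On the compact unit sphere [quad A] is at least some [a > 0]. There the coordinates are at most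
    1 in absolute value, so moving each of the n^2 entries by at most [e] changes the form by less
    than [a]; homogeneity extends this to all vectors. *)
Lemma posdef_near (T : Type) (F : set_system T) (H : T -> 'M[R]_n) A
    {FF : Filter F} :
  (forall i j, H y i j @[y --> F] --> A i j) -> posdef A ->
  \forall y \near F, posdef (H y).
Proof.
move=> HA pA; pose K := [set v : 'rV[R]_n | dotp v v = 1].
have [a a0 aP] : exists2 a, 0 < a & forall v, K v -> a <= quad A v.
  (* The unit sphere is empty when [n = 0], and any bound then works. *)
  have [K0|/nonemptyPn K0] := pselect (K !=set0); last first.
    by exists 1 => // v; rewrite K0.
  have [|c cK cP] := compact_EVT_min K0 (@compact_dotp1 R n) (f := quad A).
    apply: continuous_subspaceT => v; rewrite /quad.
    apply: (@cvg_sumr _ _ _ (nbhs v)) => i; apply: (@cvg_sumr _ _ _ (nbhs v)) => j.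
    apply: cvgM; last exact: cvg_cst.
    by apply: cvgM; exact: (@cvg_coord _ _ _ (nbhs v) id).
  exists (quad A c); last by move=> v Kv; apply: cP; rewrite inE.
  apply: pA; apply/eqP => c0; move: cK; rewrite inE /K /= c0 dotp0l => /esym/eqP.
  by rewrite oner_eq0.
pose e := a / (n%:R * n%:R + 1).
have n0 : 0 < n%:R * n%:R + 1 :> R by rewrite ltr_wpDl // mulr_ge0.
have e0 : 0 < e by rewrite divr_gt0.
have : \forall y \near F, forall i j, `|A i j - H y i j| <= e.
  apply: filter_forall => i; apply: filter_forall => j.
  by have /cvgrPdist_le := HA i j; apply.
apply: filterS => y yP v v0.
have d0 : 0 < dotp v v.
  by rewrite lt_neqAle dotp_ge0 andbT eq_sym; apply: contra_neq v0; exact: dotp_eq0.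
pose s := Num.sqrt (dotp v v); have s0 : 0 < s by rewrite sqrtr_gt0.
have s2 : s ^+ 2 = dotp v v by rewrite sqr_sqrtr ?ltW.
have Kv : dotp (s^-1 *: v) (s^-1 *: v) = 1.
  by rewrite dotpZl dotpZr mulrA -invfM -expr2 s2 mulVf ?gt_eqF.
rewrite -[v](@scalerKV _ _ s) ?gt_eqF // quadZ pmulr_rgt0 ?exprn_gt0 //.
move: (s^-1 *: v) Kv => w Kw.
suff : `|quad A w - quad (H y) w| < a.
  by have := aP w Kw; rewrite ltr_norml => ? /andP[? ?]; lra.
rewrite /quad -sumrB; apply: le_lt_trans (ler_norm_sum _ _ _) _.
apply: (@le_lt_trans _ _ (\sum_(i < n) \sum_(j < n) e)).
  apply: ler_sum => i _; rewrite -sumrB; apply: le_trans (ler_norm_sum _ _ _) _.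
  apply: ler_sum => j _; rewrite -mulrBr !normrM.
  rewrite -[leRHS]mul1r ler_pM ?mulr_ge0 //.
  by rewrite -[leRHS]mul1r ler_pM // dotp1_coord_le.
rewrite !sumr_const !card_ord -mulrnA -mulr_natl natrM /e mulrCA.
rewrite -[ltRHS]mulr1 ltr_pM2l // ltr_pdivrMr // mul1r ltrDl //.
Qed.

Lemma posdef_near_continuous (T : topologicalType) (K : T -> 'I_n -> 'I_n -> R) x :
    (forall i j, {for x, continuous (fun y => K y i j)}) ->
    posdef (\matrix_(i, j) K x i j) ->
  \forall y \near x, posdef (\matrix_(i, j) K y i j).
Proof.
move=> cK; apply: (posdef_near (F := nbhs x)) => i j; rewrite mxE.
by rewrite (_ : (fun y => _) = (fun y => K y i j)); [exact: cK|apply/funext => y; rewrite mxE].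
Qed.

End PositiveDefinite.

(** * The second-order test for height functions *)

Section StrictMin.
Variables (R : realType) (n d : nat) (U : set 'rV[R]_n).
Hypothesis oU : open U.
Variables (F : 'rV[R]_n -> 'rV[R]_d) (u : 'rV[R]_d) (x : 'rV[R]_n).
Hypotheses (sF : smooth_on U F) (Ux : U x).
Let e i : 'rV[R]_n := delta_mx 0 i.

(** The coordinate Hessian of the height in the direction [u]. When [u] is a unit normal at [y], it
    is the second fundamental form with respect to [u]. *)
Definition height_hessian y : 'M[R]_n :=
  \matrix_(i, j) dotp u ('D_(e i) ('D_(e j) F) y).

Lemma height_hessianE y i j :
  height_hessian y i j = dotp u ('D_(e i) ('D_(e j) F) y).
Proof. exact: mxE. Qed.

(** Two mean value steps along the segment from [x] to [y] express the increment by the Hessian at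
    an intermediate point. By [posdef_near_continuous] the Hessian is still positive definite
    there. *)
Lemma local_extremum_height :
    (forall i, dotp u ('D_(e i) F x) = 0) -> posdef (height_hessian x) ->
  exists2 r, 0 < r & forall y, `|y - x| < r -> U y /\
     (y != x -> dotp u (F x) < dotp u (F y)).
Proof.
move=> crit pH; pose H := height_hessian.
have : \forall y \near x, U y /\ posdef (H y).
  apply: filterI; first exact: open_nbhs_nbhs.
  apply: (posdef_near_continuous
    (K := fun y i j => dotp u ('D_(e i) ('D_(e j) F) y)) _ pH) => i j.
  have C := smooth_continuous (smooth_derive (e i) (smooth_derive (e j) sF)) Ux.
  exact: (@cvg_dotp R d _ (nbhs x) (cst u) _ u _ _ (cvg_cst _) C).
move=> /nbhs_norm[r r0 rP].
exists r => // y yr; have [Uy _] := rP _ yr; split => // yx.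
pose v := y - x; have v0 : v != 0 by rewrite subr_eq0.
have seg s : 0 <= s <= 1 -> `|x + s *: v - x| < r.
  move=> /andP[s0 s1]; rewrite addrAC subrr add0r normrZ ger0_norm //.
  by apply: le_lt_trans yr; rewrite ler_piMl.
have Useg s : 0 <= s <= 1 -> U (x + s *: v) by move=> /seg/rP [].
pose gv y := \sum_j v 0 j * dotp u ('D_(e j) F y).
have dg s : 0 <= s <= 1 ->
    is_derive (x + s *: v) v (fun y => dotp u (F y)) (gv (x + s *: v)).
  move=> /Useg Us; apply: (is_derive_eq (is_derive_dotpr u (smooth_is_derive v sF Us))).
  rewrite derive_coordE; last exact: smooth_differentiable sF Us.
  by rewrite dotpC dotp_suml; apply: eq_bigr => j _; rewrite dotpZl dotpC.
have dgv s : 0 <= s <= 1 -> is_derive (x + s *: v) v gv (quad (H (x + s *: v)) v).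
  move=> /Useg Us; rewrite /quad exchange_big /=; apply: is_derive_sumr => j.
  have sj := smooth_derive (e j) sF.
  apply: (is_derive_eq (is_deriveZ (v 0 j)
    (is_derive_dotpr u (smooth_is_derive v sj Us)))).
  rewrite derive_coordE; last exact: smooth_differentiable sj Us.
  rewrite dotpC dotp_suml /GRing.scale /= mulr_sumr.
  by apply: eq_bigr => i _; rewrite dotpZl dotpC /H height_hessianE; ring.
have [c /andP[c0 c1] gc] := MVT_line ltr01 dg.
have [s /andP[s0 s1]|t /andP[t0 tc] gt] := @MVT_line _ _ gv (fun y => quad (H y) v) x v c c0.
  by apply: dgv; rewrite s0 (le_trans s1 (ltW c1)).
have gvx : gv x = 0 by rewrite /gv big1 // => j _; rewrite crit mulr0.
rewrite gvx subr0 in gt.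
have xv : x + 1 *: v = y by rewrite scale1r addrC subrK.
rewrite xv mul1r gt in gc; rewrite -subr_gt0 gc pmulr_rgt0 //.
have [|_ pH'] := rP (x + t *: v); last exact: pH'.
by apply/seg; rewrite ltW // ltW // (lt_trans tc).
Qed.

End StrictMin.

(** * Passing points seen in a chart *)

Section Chart.
Variables (R : realType) (n : nat) (T : topologicalType) (U : set 'rV[R]_n).
Variable psi : 'rV[R]_n -> T.
Hypothesis oU : open U.
Hypothesis psi_cont : forall x, U x -> {for x, continuous psi}.
Hypothesis psi_open : forall x N, U x -> nbhs x N -> nbhs (psi x) (psi @` N).
Implicit Types (x y a b v : 'rV[R]_n).

Definition seg a b : set T := (fun t => psi (a + t *: (b - a))) @` `[0, 1].

Lemma seg_connected a b :
  (forall t, 0 <= t <= 1 -> U (a + t *: (b - a))) -> connected (seg a b).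
Proof.
move=> Uab; apply: connected_continuous_connected; first exact: segment_connected.
apply: continuous_in_subspaceT => t; rewrite inE /= in_itv /= => tI.
have c1 : {for t, continuous (fun t : R => a + t *: (b - a))}.
  by apply: continuousD; [exact: cst_continuous|exact: scalel_continuous].
exact: (@continuous_comp _ _ _ _ psi t c1 (psi_cont (Uab _ tI))).
Qed.

Lemma seg_start a b : seg a b (psi a).
Proof. by exists 0; rewrite ?scale0r ?addr0 //= in_itv /= lexx ler01. Qed.

Lemma seg_end a b : seg a b (psi b).
Proof.
by exists 1; rewrite ?scale1r ?(addrC a) ?subrK //= in_itv /= lexx ler01.
Qed.

Lemma ball_segment x r a b t : 0 <= t <= 1 ->
  `|a - x| < r -> `|b - x| < r -> `|a + t *: (b - a) - x| < r.
Proof.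
move=> /andP[t0 t1] ar br.
have -> : a + t *: (b - a) - x = (1 - t) *: (a - x) + t *: (b - x).
  by apply/rowP => i; rewrite !mxE; ring.
apply: le_lt_trans (ler_normD _ _) _; rewrite !normrZ !ger0_norm ?subr_ge0 //.
by case: (ltrP t 1) => t1'; nra.
Qed.

(** The image of a ball is a union of connected segments issuing from its centre. *)
Lemma chart_locally_connected x N : U x -> nbhs (psi x) N ->
  exists C, [/\ connected C, nbhs (psi x) C & C `<=` N].
Proof.
move=> Ux Nx; have : nbhs x (U `&` psi @^-1` N).
  by apply: filterI; [exact: open_nbhs_nbhs|exact: psi_cont].
move=> /nbhs_norm[r r0 rP].
pose B := [set y | `|y - x| < r].
have xB : `|x - x| < r by rewrite subrr normr0.
exists (\bigcup_(y in B) seg x y); split.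
- apply: bigcup_connected; first by exists (psi x) => y _; exact: seg_start.
  move=> y yB; apply: seg_connected => t tI.
  by have [] := rP _ (ball_segment tI xB yB).
- apply: (filterS _ (psi_open Ux (N := B) _)).
    by move=> _ [y yB <-]; exists y => //; exact: seg_end.
  exact: (norm_nbhs r0).
- move=> _ [y yB [t + <-]]; rewrite /= in_itv /= => tI.
  by have [] := rP _ (ball_segment tI xB yB).
Qed.

Variables (f : T -> R) (x : 'rV[R]_n).
Hypothesis Ux : U x.
Hypothesis f_cont : continuous f.

Lemma chart_strict_local_min r : 0 < r ->
  (forall y, `|y - x| < r -> y != x -> f (psi x) < f (psi y)) ->
  strict_local_min f (psi x).
Proof.
move=> r0 rP; pose B := [set y | `|y - x| < r].
apply: (filterS _ (psi_open Ux (N := B) _)); last exact: (norm_nbhs r0).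
move=> _ [y yB <-] yx; apply: rP => //; apply/eqP => e.
by apply: yx; rewrite e.
Qed.

Lemma chart_closure_below y v : U y ->
    (\forall t \near 0^'+, f (psi (y + t *: v)) < f (psi x)) ->
  closure [set z | f z < f (psi x)] (psi y).
Proof.
move=> Uy tP W yW; have yW' : nbhs y (psi @^-1` W) by exact: psi_cont.
have cv : (fun t : R => y + t *: v) @ 0^'+ --> y.
  apply: cvg_at_right_filter; rewrite -{2}[y]addr0 -(scale0r v).
  by apply: cvgD; [exact: cvg_cst|exact: scalel_continuous].
have : \forall t \near 0^'+, W (psi (y + t *: v)) by exact: (cv _ yW').
by move=> /(filterI tP) /filter_ex [t [? ?]]; exists (psi (y + t *: v)).
Qed.

(** Every point of a small ball that lies below the level slides down by [t0 *: v] and then runs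
    straight to the common point [b]. The first leg descends, and the second stays in a ball around
    [b] where [f] is below the level. *)
Lemma chart_passing_regular v r : 0 < r ->
    (forall y, `|y - x| < r -> U y) ->
    (forall y t, 0 < t -> `|y - x| < r -> `|y - t *: v - x| < r ->
       f (psi (y - t *: v)) < f (psi y)) ->
  passing_point f (psi x).
Proof.
move=> r0 rU rP; pose c := f (psi x).
(* Sliding by at most [t0] moves a point by less than [r / 2], so the half ball stays in the ball;
   the [+ 1] keeps the denominator positive. *)
pose t0 := r / 2 / (`|v| + 1); pose b := x - t0 *: v.
have v1 : 0 < `|v| + 1 by rewrite ltr_wpDl.
have t0_gt0 : 0 < t0 by rewrite !divr_gt0.
have t0v : t0 * `|v| < r / 2.
  by rewrite /t0 mulrAC ltr_pdivrMr // ltr_pM2l ?ltrDl // divr_gt0.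
have shift y t : 0 <= t <= t0 -> `|y - x| < r / 2 -> `|y - t *: v - x| < r.
  move=> /andP[t_ge0 tt0] yr; rewrite addrAC.
  apply: le_lt_trans (ler_normB _ _) _; rewrite normrZ ger0_norm //.
  have : t * `|v| <= t0 * `|v| by rewrite ler_wpM2r.
  by move: yr t0v; lra.
have r20 : 0 < r / 2 by rewrite divr_gt0.
have br : `|b - x| < r by apply: shift; rewrite ?subrr ?normr0 ?lexx ?ltW.
have fb : f (psi b) < c by apply: rP => //; rewrite subrr normr0.
have /nbhs_norm[s s0 sP] : nbhs b [set w | f (psi w) < c].
  have cfb := @continuous_comp _ _ _ psi f b (psi_cont (rU _ br)) (@f_cont _).
  exact: (cfb [set w | w < c] (open_nbhs_nbhs (conj (@open_lt _ c) fb))).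
(* The radius [s] makes the translate of the ball by [- t0 *: v] fall into the low ball around
   [b]. *)
pose B := [set y | `|y - x| < Num.min s (r / 2)].
have Bs y : B y -> `|y - x| < s by rewrite /B /= lt_min => /andP[].
have Br y : B y -> `|y - x| < r / 2 by rewrite /B /= lt_min => /andP[].
have Br' y : B y -> `|y - x| < r by move=> /Br yr; apply: lt_trans yr _; lra.
have B0 : 0 < Num.min s (r / 2) by rewrite lt_min s0.
exists (psi @` B); first by apply: psi_open => //; exact: (norm_nbhs B0).
have inseg y t : y + t *: (y - t0 *: v - y) = y - (t * t0) *: v.
  by rewrite addrAC subrr add0r scalerN scalerA.
have tt0 t : 0 <= t <= 1 -> 0 <= t * t0 <= t0.
  by move=> /andP[t_ge0 t1]; rewrite mulr_ge0 ?ler_piMl // ltW.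
have bdist y : y - t0 *: v - b = y - x by rewrite /b opprB addrA subrK.
have seg2 y t : B y -> 0 <= t <= 1 ->
    `|y - t0 *: v + t *: (b - (y - t0 *: v)) - b| < s.
  by move=> By tI; apply: ball_segment; rewrite // ?bdist ?subrr ?normr0 //; exact: Bs.
have seg2' y t : B y -> 0 <= t <= 1 ->
    `|y - t0 *: v + t *: (b - (y - t0 *: v)) - x| < r.
  move=> By tI; apply: ball_segment => //; apply: shift; last exact: Br.
  by rewrite lexx ltW.
split.
  exists (\bigcup_(y in B `&` [set y | f (psi y) < c])
            (seg y (y - t0 *: v) `|` seg (y - t0 *: v) b)); split.
  - apply: bigcup_connected; first by exists (psi b) => y _; right; exact: seg_end.
    move=> y [By _]; apply: connectedU.
    + by exists (psi (y - t0 *: v)); split; [exact: seg_end|exact: seg_start].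
    + by apply: seg_connected => t tI; rewrite inseg; apply/rU/shift; [exact: tt0|exact: Br].
    + by apply: seg_connected => t tI; apply/rU/seg2'.
  - move=> _ [y [By yc] [] [t + <-]]; rewrite /= in_itv /= => tI; last exact/sP/seg2.
    rewrite inseg; have [->|t_neq0] := eqVneq t 0; first by rewrite mul0r scale0r subr0.
    apply: lt_trans yc; apply: rP.
    + by rewrite mulr_gt0 // lt_neqAle eq_sym t_neq0; case/andP: tI.
    + exact: Br'.
    + by apply: shift; [exact: tt0|exact: Br].
  - by move=> _ [[y By <-] yc]; exists y => //; left; exact: seg_start.
move=> _ [[y By <-] yc]; apply: (@chart_closure_below y (- v)); first exact/rU/Br'.
rewrite -yc; near=> t; rewrite scalerN; apply: rP => //; first exact: Br'.
apply: shift; last exact: Br.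
apply/andP; split => //; near: t; exact: nbhs_right_le.
Unshelve. all: by end_near. Qed.

(** The punctured ball is connected thanks to the two distinct axes: each point is joined to [b i]
    by a segment, or through [b j] when that segment would hit [x]. *)
Lemma chart_passing_max r (i j : 'I_n) : 0 < r -> i != j ->
    (forall y, `|y - x| < r -> U y) ->
    (forall y, `|y - x| < r -> y != x -> f (psi y) < f (psi x)) ->
  passing_point f (psi x).
Proof.
move=> r0 ij rU rP; pose c := f (psi x).
pose e k : 'rV[R]_n := delta_mx 0 k.
have e1 k : `|e k| <= 1.
  apply: norm_le_coord => // l; rewrite mxE eqxx /=.
  by case: (l == k); rewrite ?normr1 ?normr0.
pose s := r / 2; pose b k := x + s *: e k.
have s0 : 0 < s by rewrite divr_gt0.
have br k : `|b k - x| < r.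
  rewrite addrAC subrr add0r normrZ gtr0_norm //.
  by have := e1 k; rewrite /s; nra.
have xr : `|x - x| < r by rewrite subrr normr0.
pose B := [set y | `|y - x| < r].
exists (psi @` B); first by apply: psi_open => //; exact: (norm_nbhs r0).
pose avoid a d := forall t, 0 <= t <= 1 -> a + t *: (d - a) != x.
have coord k a t l : (a + t *: (b k - a)) 0 l = x 0 l ->
    (1 - t) * (a 0 l - x 0 l) + t * s * (l == k)%:R = 0.
  move=> E; rewrite -[RHS](subrr (x 0 l)) -{2}E !mxE eqxx /=; ring.
have eik : (i == j) = false by exact: negbTE.
have eki : (j == i) = false by rewrite eq_sym.
have avoid_ji : avoid (b j) (b i).
  move=> t _; apply/eqP => /rowP E; have := coord i (b j) t i (E i).
  have := coord i (b j) t j (E j); rewrite !mxE !eqxx eik eki /= => Ej Ei.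
  have : s = 0 by lra.
  by move: s0 => /[swap] ->; rewrite ltxx.
(* If the segment to [b i] hits [x], then [y] and [x] agree in coordinate [j]. The segment to [b j]
   moves away from [x] in that coordinate, so it could only meet [x] at its start [y]. *)
have avoid_or y : y != x -> ~ avoid y (b i) -> avoid y (b j).
  move=> yx /existsNP[t /not_implyP[tI /negP]]; rewrite negbK => /eqP/rowP E1 t' _.
  apply/eqP => /rowP E2; move/eqP: yx; apply.
  have := coord _ _ _ _ (E1 i); have := coord _ _ _ _ (E1 j).
  have := coord _ _ _ _ (E2 j); rewrite !eqxx eki /= !mulr0 !mulr1 addr0 => Ej' Ej Ei.
  have t1 : 1 - t != 0.
    apply/eqP => t1; move: Ei; rewrite t1 mul0r add0r (_ : t = 1); last lra.
    by rewrite mul1r => se; move: s0; rewrite se ltxx.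
  have yj : y 0 j - x 0 j = 0 by apply: (mulfI t1); rewrite mulr0.
  have t'0 : t' = 0.
    by apply: (mulIf (lt0r_neq0 s0)); rewrite mul0r -Ej' yj mulr0 add0r.
  by apply/rowP => l; rewrite -(E2 l) t'0 scale0r addr0.
pose path y := if pselect (avoid y (b i)) then seg y (b i)
  else seg y (b j) `|` seg (b j) (b i).
have seg_sub a d : `|a - x| < r -> `|d - x| < r -> avoid a d ->
    connected (seg a d) /\ seg a d `<=` [set z | f z < c].
  move=> ar dr ad; split.
    by apply: seg_connected => t tI; apply/rU/ball_segment.
  move=> _ [t + <-]; rewrite /= in_itv /= => tI.
  by apply: rP; [exact: ball_segment|exact: ad].
have pathP y : B y -> y != x ->
    [/\ connected (path y), path y `<=` [set z | f z < c],
        path y (psi y) & path y (psi (b i))].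
  move=> By yx; rewrite /path; case: pselect => [yi|/= nyi].
    have [? ?] := seg_sub _ _ By (br i) yi.
    by split => //; [exact: seg_start|exact: seg_end].
  have [? ?] := seg_sub _ _ By (br j) (avoid_or _ yx nyi).
  have [? ?] := seg_sub _ _ (br j) (br i) avoid_ji.
  split; last 2 first.
  - by left; exact: seg_start.
  - by right; exact: seg_end.
  - by apply: connectedU => //; exists (psi (b j)); split; [exact: seg_end|exact: seg_start].
  - by rewrite subUset.
split.
  exists (\bigcup_(y in B `&` [set y | y != x]) path y); split.
  - apply: bigcup_connected; last by move=> y [By yx]; have [] := pathP y By yx.
    by exists (psi (b i)) => y [By yx]; have [] := pathP y By yx.
  - by apply: bigcup_sub => y [By yx]; have [] := pathP y By yx.
  - move=> _ [[y By <-] /= yc]; have yx : y != x.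
      by apply: contraTneq yc => ->; rewrite ltxx.
    by exists y => //; have [] := pathP y By yx.
move=> _ [[y By <-] /= yc].
(* Within the ball the level set is [x] alone, and it is a limit of lower points along any axis. *)
have -> : y = x.
  by apply/eqP; apply: contraTT isT => yx; have := rP _ By yx; rewrite yc ltxx.
apply: (chart_closure_below (v := e i)) => //; near=> t.
have t0 : 0 < t by [].
apply: rP.
  rewrite addrAC subrr add0r normrZ gtr0_norm //.
  apply: (@le_lt_trans _ _ (t * 1)); first by rewrite ler_wpM2l // ltW.
  by rewrite mulr1; near: t; exact: nbhs_right_lt.
apply/eqP => /rowP/(_ i); rewrite !mxE !eqxx /= mulr1 => E.
have : t = 0 by lra.
by move: t0 => /[swap] ->; rewrite ltxx.
Unshelve. all: by end_near. Qed.

End Chart.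

(** * Derivability of determinants and inverse matrices *)

Section DeriveDet.
Variables (R : realType) (V : normedModType R).
Implicit Types (x v : V).

Lemma derivable_sumr (I : Type) (s : seq I) (h : I -> V -> R) x v :
  (forall i, derivable (h i) x v) ->
  derivable (fun y => \sum_(i <- s) h i y) x v.
Proof.
move=> dh; have dhi i : is_derive x v (h i) ('D_v (h i) x) by exact: derivableP.
by have [] := is_derive_sumr s dhi.
Qed.

Lemma derivable_mulr (f g : V -> R) x v : derivable f x v -> derivable g x v ->
  derivable (fun y => f y * g y) x v.
Proof. by move=> df dg; have := derivableM df dg. Qed.

Lemma derivable_prodr (I : Type) (s : seq I) (h : I -> V -> R) x v :
  (forall i, derivable (h i) x v) ->
  derivable (fun y => \prod_(i <- s) h i y) x v.
Proof.
move=> dh; elim: s => [|i s IH].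
  rewrite (_ : (fun _ => _) = cst 1); first exact: derivable_cst.
  by apply/funext => y; rewrite big_nil.
rewrite (_ : (fun _ => _) = (fun y => h i y * \prod_(j <- s) h j y)).
  exact: (derivable_mulr (dh i) IH).
by apply/funext => y; rewrite big_cons.
Qed.

Lemma derivable_det n (A : V -> 'M[R]_n) x v :
  (forall i j, derivable (fun y => A y i j) x v) ->
  derivable (fun y => \det (A y)) x v.
Proof.
move=> dA; apply: derivable_sumr => s.
apply: derivable_mulr; first exact: derivable_cst.
by apply: derivable_prodr => i; exact: dA.
Qed.

(** Cramer's rule makes the entries quotients of polynomials in those of [A]. Invertibility is
    required near [x] because [invmx] is the identity function on singular matrices. *)
Lemma derivable_invmx n (A : V -> 'M[R]_n) x v i j :
    (\forall y \near x, A y \in unitmx) ->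
    (forall i j, derivable (fun y => A y i j) x v) ->
  derivable (fun y => invmx (A y) i j) x v.
Proof.
move=> uA dA.
have dcof k l : derivable (fun y => cofactor (A y) k l) x v.
  apply: derivable_mulr; first exact: derivable_cst.
  apply: derivable_det => a b.
  rewrite (_ : (fun _ => _) = fun y => A y (lift k a) (lift l b)); first exact: dA.
  by apply/funext => y; rewrite !mxE.
apply: (@near_eq_derivable _ _ _ (fun y => (\det (A y))^-1 * cofactor (A y) j i)).
  near=> y; rewrite /invmx (_ : A y \in unitmx) ?mxE ?mxE //.
  by near: y.
apply: derivable_mulr; last exact: dcof.
apply: derivableV; last exact: derivable_det.
by have := nbhs_singleton uA; rewrite unitmxE unitfE.
Unshelve. all: by end_near. Qed.

End DeriveDet.

(** * The Gauss equation in coordinates *)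

Section GaussEquation.
Variables (R : realType) (n d : nat) (U : set 'rV[R]_n).
(* F1, F2, F3 are the first, second and third partial derivatives of an
   immersion with Gram matrix G. *)
Variables (G : 'rV[R]_n -> 'M[R]_n) (F1 : 'I_n -> 'rV[R]_n -> 'rV[R]_d).
Variables (F2 : 'I_n -> 'I_n -> 'rV[R]_n -> 'rV[R]_d).
Variables (F3 : 'I_n -> 'I_n -> 'I_n -> 'rV[R]_n -> 'rV[R]_d).
Hypothesis oU : open U.
Hypothesis gramE : forall x i j, U x -> G x i j = dotp (F1 i x) (F1 j x).
Hypothesis gram_unit : forall x, U x -> G x \in unitmx.
Hypothesis dF1 : forall x i j, U x -> is_derive x (delta_mx 0 i) (F1 j) (F2 i j x).
Hypothesis dF2 : forall x i j k, U x ->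
  is_derive x (delta_mx 0 i) (F2 j k) (F3 i j k x).
Hypothesis F2C : forall x i j, U x -> F2 i j x = F2 j i x.
Hypothesis F3C : forall x i j k, U x -> F3 i j k x = F3 j i k x.

Let e i : 'rV[R]_n := delta_mx 0 i.

Lemma is_derive_gram k i j x : U x ->
  is_derive x (e k) (fun y => G y i j)
    (dotp (F2 k i x) (F1 j x) + dotp (F1 i x) (F2 k j x)).
Proof.
move=> Ux; apply: (@near_eq_is_derive _ _ _ (fun y => dotp (F1 i y) (F1 j y))).
  by apply: near_open oU _ _ Ux _ => y Uy; rewrite gramE.
by apply: is_derive_dotp; exact: dF1.
Qed.

Lemma partial_gram k i j x : U x -> partial k (fun y => G y i j) x =
  dotp (F2 k i x) (F1 j x) + dotp (F1 i x) (F2 k j x).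
Proof. by move=> /(is_derive_gram k i j) [_]. Qed.

(** Of the six products given by the three metric derivatives, four cancel by symmetry of [F2] and
    the other two coincide. *)
Lemma christoffelE l i j x : U x ->
  christoffel G l i j x = \sum_m invmx (G x) l m * dotp (F2 i j x) (F1 m x).
Proof.
move=> Ux; rewrite /christoffel mulr_sumr; apply: eq_bigr => m _.
rewrite !partial_gram // (F2C j i) // (F2C m i) // (F2C m j) //.
rewrite (dotpC (F1 j x)).
by field.
Qed.

(** Lowering the index removes [invmx] and gives the identity to be differentiated for the
    curvature. *)
Lemma christoffel_gram i j m x : U x ->
  \sum_l christoffel G l i j x * G x l m = dotp (F2 i j x) (F1 m x).
Proof.
move=> Ux; have symG a b : invmx (G x) a b = invmx (G x) b a.
  suff E : (invmx (G x))^T = invmx (G x) by rewrite -[in LHS]E mxE.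
  by rewrite trmx_inv; congr invmx; apply/matrixP => k l; rewrite mxE !gramE // dotpC.
under eq_bigr => l _ do rewrite christoffelE // mulr_suml.
rewrite exchange_big /=.
transitivity (\sum_k dotp (F2 i j x) (F1 k x) * (invmx (G x) *m G x) k m).
  apply: eq_bigr => k _; rewrite mxE mulr_sumr; apply: eq_bigr => l _.
  by rewrite symG; ring.
rewrite mulVmx ?gram_unit // (bigD1 m) //= mxE eqxx mulr1 big1 ?addr0 // => k km.
by rewrite mxE (negbTE km) mulr0.
Qed.

Lemma derivable_christoffel l i j k x : U x ->
  derivable (christoffel G l i j) x (e k).
Proof.
move=> Ux; apply: (@near_eq_derivable _ _ _
  (fun y => \sum_m invmx (G y) l m * dotp (F2 i j y) (F1 m y))).
  by apply: near_open oU _ _ Ux _ => y Uy; rewrite christoffelE.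
apply: derivable_sumr => m; apply: derivable_mulr.
  apply: derivable_invmx.
    by apply: near_open oU _ _ Ux _ => y; exact: gram_unit.
  move=> a b; apply: (@near_eq_derivable _ _ _ (fun y => dotp (F1 a y) (F1 b y))).
    by apply: near_open oU _ _ Ux _ => y Uy; rewrite gramE.
  by have [] := is_derive_dotp (dF1 k a Ux) (dF1 k b Ux).
by have [] := is_derive_dotp (dF2 k i j Ux) (dF1 k m Ux).
Qed.

(** The vector-valued second fundamental form: by the Gauss formula, the subtracted sum is the
    tangential component. *)
Definition normal_part j k x : 'rV[R]_d :=
  F2 j k x - \sum_l christoffel G l j k x *: F1 l x.

Lemma normal_part_normal j k m x : U x -> dotp (normal_part j k x) (F1 m x) = 0.
Proof.
move=> Ux; rewrite dotpBl dotp_suml -(christoffel_gram j k m Ux).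
apply/eqP; rewrite subr_eq0; apply/eqP; apply: eq_bigr => l _.
by rewrite dotpZl gramE.
Qed.

Lemma dotp_normal_part j k i m x : U x ->
  dotp (normal_part j k x) (F2 i m x) =
  dotp (normal_part j k x) (normal_part i m x).
Proof.
move=> Ux; rewrite {3}/normal_part dotpBr (dotpC _ (\sum_l _)) dotp_suml.
rewrite big1 ?subr0 // => l _.
by rewrite dotpZl dotpC normal_part_normal // mulr0.
Qed.

(** The curvature before antisymmetrising in [i] and [j]. Both sides of [christoffel_gram] are
    differentiated along [e i], and the two values are compared. *)
Lemma riemann_gram_half i j k m x : U x ->
  \sum_l ('D_(e i) (christoffel G l j k) x
          + \sum_p christoffel G l i p x * christoffel G p j k x) * G x l m =
  dotp (F3 i j k x) (F1 m x)
  + dotp (normal_part j k x) (normal_part i m x).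
Proof.
move=> Ux.
have Dchr l := derivableP (@derivable_christoffel l j k i x Ux).
have D1 : is_derive x (e i) (fun y => \sum_l christoffel G l j k y * G y l m)
    (\sum_l ('D_(e i) (christoffel G l j k) x * G x l m
             + christoffel G l j k x *
               (dotp (F2 i l x) (F1 m x) + dotp (F1 l x) (F2 i m x)))).
  apply: is_derive_sumr => l.
  apply: (is_derive_eq (is_deriveM (Dchr l) (is_derive_gram i l m Ux))).
  by rewrite /GRing.scale /= addrC (mulrC (G x l m)).
have D2 : is_derive x (e i) (fun y => \sum_l christoffel G l j k y * G y l m)
    (dotp (F3 i j k x) (F1 m x) + dotp (F2 j k x) (F2 i m x)).
  apply: (@near_eq_is_derive _ _ _ (fun y => dotp (F2 j k y) (F1 m y))).
    by apply: near_open oU _ _ Ux _ => y Uy; rewrite christoffel_gram.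
  by apply: is_derive_dotp; [exact: dF2|exact: dF1].
have := etrans (esym (derive_val (is_derive := D1))) (derive_val (is_derive := D2)).
rewrite big_split /= => E.
under eq_bigr => l _ do rewrite mulrDl; rewrite big_split /=.
(* The tangential component of [F2 j k] cancels against this sum, leaving a product of normal
   parts. *)
have tang : \sum_l christoffel G l j k x * dotp (F1 l x) (F2 i m x) =
    dotp (F2 j k x) (F2 i m x) - dotp (normal_part j k x) (F2 i m x).
  rewrite -dotpBl opprB addrC subrK dotp_suml.
  by apply: eq_bigr => l _; rewrite dotpZl.
(* Using [christoffel_gram] once more yields the terms of the curvature that are quadratic in the
   Christoffel symbols. *)
have quad_term : \sum_l christoffel G l j k x * dotp (F2 i l x) (F1 m x) =
    \sum_l (\sum_p christoffel G l i p x * christoffel G p j k x) * G x l m.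
  under eq_bigr => l _ do rewrite -christoffel_gram // mulr_sumr.
  rewrite exchange_big; apply: eq_bigr => l _; rewrite mulr_suml.
  by apply: eq_bigr => p _; ring.
rewrite -quad_term -dotp_normal_part //.
move: E; under [X in _ + X = _]eq_bigr => l _ do rewrite mulrDr.
by rewrite big_split /= tang => E; lra.
Qed.

(** The Gauss equation: the third derivatives are symmetric in [i] and [j], so they drop out of the
    difference of two halves. *)
Lemma riemann_gram i j k m x : U x ->
  \sum_l riemann G l i j k x * G x l m =
  dotp (normal_part j k x) (normal_part i m x)
  - dotp (normal_part i k x) (normal_part j m x).
Proof.
move=> Ux; transitivity
  (\sum_l ('D_(e i) (christoffel G l j k) x
          + \sum_p christoffel G l i p x * christoffel G p j k x) * G x l m
   - \sum_l ('D_(e j) (christoffel G l i k) x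
          + \sum_p christoffel G l j p x * christoffel G p i k x) * G x l m).
  have split4 (a b c c' g : R) : (a - b + (c - c')) * g = (a + c) * g - (b + c') * g by ring.
  by rewrite -sumrB; apply: eq_bigr => l _; rewrite /riemann sumrB split4.
rewrite (riemann_gram_half i j k m Ux) (riemann_gram_half j i k m Ux) F3C //.
by rewrite opprD addrACA subrr add0r.
Qed.

(** Codimension one enters as the assumption that normal vectors are multiples of [N]: normal parts
    become scalars [h j k], and the Gauss equation can be traced. The result is quadratic in [N],
    hence blind to its sign. *)
Lemma ricci_gauss x (N : 'rV[R]_d) : U x -> dotp N N = 1 ->
    (forall m, dotp (F1 m x) N = 0) ->
    (forall w, (forall m, dotp w (F1 m x) = 0) -> w = dotp w N *: N) ->
  let h : 'M[R]_n := \matrix_(j, k) dotp N (F2 j k x) in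
  ricci G x = \tr (h *m invmx (G x)) *: h - h *m invmx (G x) *m h.
Proof.
move=> Ux N1 NF NP h; have hE j k : h j k = dotp N (F2 j k x) by rewrite mxE.
have WE j k : normal_part j k x = h j k *: N.
  rewrite [LHS]NP; last by move=> m; exact: normal_part_normal.
  congr (_ *: _); rewrite hE dotpBl dotp_suml big1 ?subr0 1?dotpC // => l _.
  by rewrite dotpZl NF mulr0.
have WW i j k m : dotp (normal_part j k x) (normal_part i m x) = h j k * h i m.
  by rewrite !WE dotpZl dotpZr N1 mulr1.
(* The index lowered in [riemann_gram] is raised again by multiplying with the inverse metric. *)
have riemE l i j k : riemann G l i j k x =
    \sum_m (h j k * h i m - h i k * h j m) * invmx (G x) m l.
  pose r : 'rV[R]_n := \row_l riemann G l i j k x.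
  have -> : riemann G l i j k x = (r *m G x *m invmx (G x)) 0 l.
    by rewrite mulmxK ?gram_unit // mxE.
  rewrite mxE; apply: eq_bigr => m _; congr (_ * _); rewrite mxE.
  rewrite -(WW i j k m) -(WW j i k m) -(riemann_gram i j k m Ux).
  by apply: eq_bigr => p _; rewrite mxE.
apply/matrixP => j k; rewrite !mxE -[RHS]/(_ - _).
rewrite /mxtrace mulr_suml -sumrB; apply: eq_bigr => i _; rewrite riemE.
rewrite !mxE -hE mulr_suml mulr_suml -sumrB.
apply: eq_bigr => m _; rewrite -!hE; ring.
Qed.

End GaussEquation.

(** * Linear algebra: unit normals and positive Ricci curvature *)

Section Algebra.
Variables (R : realType).

Lemma tr_mulmx_tr m n (X : 'M[R]_(m, n)) :
  \tr (X *m X^T) = \sum_i \sum_j X i j ^+ 2.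
Proof.
by apply: eq_bigr => i _; rewrite !mxE; apply: eq_bigr => j _; rewrite !mxE expr2.
Qed.

Lemma quadD n (A B : 'M[R]_n) v : quad (A + B) v = quad A v + quad B v.
Proof. by rewrite !quadE mulmxDr mulmxDl mxE. Qed.

Lemma quad_scale n a (A : 'M[R]_n) v : quad (a *: A) v = a * quad A v.
Proof. by rewrite !quadE -scalemxAr -scalemxAl mxE. Qed.

Lemma quadN n (A : 'M[R]_n) v : quad (- A) v = - quad A v.
Proof. by rewrite -scaleN1r quad_scale mulN1r. Qed.

(* AM-GM: 2 |w_i w_j X_ij| <= c (w_i w_j)^2 + X_ij^2 / c with c = K / |w|^2. *)
Lemma quad_ge_frobenius n (X : 'M[R]_n) (w : 'rV[R]_n) (K : R) : 0 < K ->
  \tr (X *m X^T) <= K ^+ 2 -> - (K * dotp w w) <= quad X w.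
Proof.
move=> K0 XK; have [w0|/eqP w0] := eqVneq (dotp w w) 0.
  by rewrite w0 mulr0 oppr0 (dotp_eq0 w0) quadE mul0mx mul0mx mxE.
have W0 : 0 < dotp w w by rewrite lt_neqAle dotp_ge0 andbT eq_sym; exact/eqP.
set W := dotp w w in W0 *; pose c : R := K / W.
have c0 : 0 < c by rewrite divr_gt0.
have pointwise i j : - (c * (w 0 i * w 0 j) ^+ 2 + X i j ^+ 2 / c)
    <= 2 * (w 0 i * w 0 j * X i j).
  rewrite -subr_ge0.
  have -> : 2 * (w 0 i * w 0 j * X i j) - - (c * (w 0 i * w 0 j) ^+ 2 + X i j ^+ 2 / c)
     = c * (w 0 i * w 0 j + X i j / c) ^+ 2.
    by field; rewrite gt_eqF.
  by rewrite mulr_ge0 ?sqr_ge0 // ltW.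
have sumw : \sum_i \sum_j (w 0 i * w 0 j) ^+ 2 = W ^+ 2.
  rewrite expr2 {1}/W {1}/dotp mulr_suml; apply: eq_bigr => i _.
  by rewrite /W /dotp mulr_sumr; apply: eq_bigr => j _; ring.
have sumD (a b : 'I_n -> R) : \sum_i a i + \sum_i b i = \sum_i (a i + b i).
  by rewrite big_split.
have : - (c * W ^+ 2 + \tr (X *m X^T) / c) <= 2 * quad X w.
  rewrite tr_mulmx_tr -sumw mulr_sumr mulr_suml sumD -sumrN /quad mulr_sumr.
  apply: ler_sum => i _; rewrite mulr_sumr mulr_suml sumD -sumrN mulr_sumr.
  by apply: ler_sum => j _; exact: pointwise.
have -> : c * W ^+ 2 = K * W by rewrite /c; field; rewrite gt_eqF.
have : \tr (X *m X^T) / c <= K * W.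
  rewrite ler_pdivrMr //; apply: le_trans XK _.
  by rewrite /c (_ : K * W * (K / W) = K ^+ 2) //; field; rewrite gt_eqF.
by lra.
Qed.

(** The vectors orthogonal to the rows form the kernel of [J^T], of rank [n.+1 - n = 1]; a generator
    is normalised. *)
Lemma unit_normal n (J : 'M[R]_(n, n.+1)) : row_free J ->
  exists N, [/\ dotp N N = 1, forall m, dotp (row m J) N = 0 &
    forall w, (forall m, dotp w (row m J) = 0) -> w = dotp w N *: N].
Proof.
move=> fJ; pose A := kermx J^T.
have rA : \rank A = 1%N.
  by rewrite mxrank_ker mxrank_tr (eqP fJ) subSnn.
have /rowV0Pn[N0 N0A N0n] : A != 0 by rewrite -mxrank_eq0 rA.
have d0 : 0 < dotp N0 N0.
  by rewrite lt_neqAle dotp_ge0 andbT eq_sym; apply: contra_neq N0n; exact: dotp_eq0.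
pose s := Num.sqrt (dotp N0 N0); have s0 : 0 < s by rewrite sqrtr_gt0.
have s2 : s ^+ 2 = dotp N0 N0 by rewrite sqr_sqrtr ?ltW.
pose N := s^-1 *: N0.
have NN : dotp N N = 1.
  by rewrite dotpZl dotpZr mulrA -invfM -expr2 s2 mulVf ?gt_eqF.
have NA : (N <= A)%MS by rewrite scalemx_sub.
have perpP w : (forall m, dotp w (row m J) = 0) <-> (w <= A)%MS.
  rewrite (sameP sub_kermxP eqP); split=> [wJ|/eqP/rowP wJ m].
    apply/eqP/rowP => m; rewrite !mxE -[RHS](wJ m); apply: eq_bigr => i _.
    by rewrite !mxE.
  have := wJ m; rewrite !mxE => <-; apply: eq_bigr => i _; by rewrite !mxE.
exists N; split => // [m|w /perpP wA]; first by rewrite dotpC; exact: (perpP N).2.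
have N_neq0 : N != 0.
  by apply/eqP => N0'; move/eqP: NN; rewrite N0' dotp0l eq_sym oner_eq0.
have AN : (A <= N)%MS.
  by have [_ <-] := mxrank_leqif_sup NA; rewrite rA rank_rV N_neq0.
have /sub_rVP[a ->] := submx_trans wA AN.
by rewrite dotpZl NN mulr1.
Qed.

Section PositiveRicci.
Variables (n d : nat) (J : 'M[R]_(n, d)) (G h Ric : 'M[R]_n) (k : R).
Hypothesis fJ : row_free J.
Hypothesis GE : J *m J^T = G.
Hypothesis k0 : 0 < k.

Lemma quad_gram v : quad G v = dotp (v *m J) (v *m J).
Proof. by rewrite quadE -GE dotpE trmx_mul !mulmxA. Qed.

Lemma gram_posdef : posdef G.
Proof.
move=> v v0; rewrite quad_gram lt_neqAle dotp_ge0 andbT eq_sym.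
apply: contra_neq v0 => /dotp_eq0 vJ; apply: (row_free_inj fJ).
by rewrite vJ mul0mx.
Qed.

Lemma gram_unitmx : G \in unitmx.
Proof.
rewrite -row_free_unit; apply: inj_row_free => v vG.
apply/eqP; apply: contraT => /gram_posdef.
by rewrite quadE vG mul0mx mxE ltxx.
Qed.

Let trG : G^T = G.
Proof. by rewrite -GE trmx_mul trmxK. Qed.

(** Here [Q] stands in for a square root of the inverse metric, with no diagonalisation. It turns
    norms measured by [G] into Euclidean ones. *)
Lemma gram_inverse_factor :
  exists Q : 'M[R]_(n, d), Q *m Q^T = invmx G /\ J *m Q^T = 1%:M.
Proof.
exists (invmx G *m J); rewrite trmx_mul trmx_inv trG; split.
  by rewrite -mulmxA (mulmxA J) GE mulmxV ?mulmx1 ?gram_unitmx.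
by rewrite mulmxA GE mulmxV ?gram_unitmx.
Qed.

(** The tensor norm of [Ric - k *: G] is the Frobenius norm of [X], which bounds its quadratic form.
    Hence [quad Ric v] is at least [k / 2] times [quad G v]; any bound smaller than [k] would leave
    a positive factor. *)
Lemma posdef_of_close :
  Num.sqrt (\tr (invmx G *m (Ric - k *: G) *m invmx G *m (Ric - k *: G)^T)) <= k / 2 ->
  posdef Ric.
Proof.
set B := Ric - k *: G => Bk v v0; have [Q [QQ JQ]] := gram_inverse_factor.
pose X := Q^T *m B *m Q.
have trX : \tr (invmx G *m B *m invmx G *m B^T) = \tr (X *m X^T).
  by rewrite -QQ /X !trmx_mul trmxK -!mulmxA mxtrace_mulC -!mulmxA.
have X0 : 0 <= \tr (X *m X^T).
  by rewrite tr_mulmx_tr; do 2!(apply: sumr_ge0 => ? _); exact: sqr_ge0.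
have k20 : 0 < k / 2 by rewrite divr_gt0.
have XK : \tr (X *m X^T) <= (k / 2) ^+ 2.
  rewrite -(sqr_sqrtr X0) -trX; apply: lerXn2r => //; rewrite nnegrE ?sqrtr_ge0 //.
  exact: ltW.
have := quad_ge_frobenius (v *m J) k20 XK.
have -> : quad X (v *m J) = quad B v.
  rewrite !quadE /X trmx_mul !mulmxA -(mulmxA v J) JQ mulmx1 -!mulmxA.
  by rewrite (_ : Q *m (J^T *m v^T) = v^T) // mulmxA -[Q *m _]trmxK trmx_mul trmxK JQ trmx1 mul1mx.
rewrite -quad_gram.
have -> : quad B v = quad Ric v - k * quad G v.
  by rewrite /B quadD quadN quad_scale.
have := gram_posdef v0; move: (quad G v) => q q0; nra.
Qed.

Lemma definite_of_ricci : h^T = h -> posdef Ric ->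
  Ric = \tr (h *m invmx G) *: h - h *m invmx G *m h ->
  posdef h \/ posdef (- h).
Proof.
set t := \tr _ => hs pR RE; have [Q [QQ _]] := gram_inverse_factor.
have th v : v != 0 -> 0 < t * quad h v.
  move=> v0; have := pR v v0; rewrite RE quadD quad_scale.
  suff : 0 <= - quad (- (h *m invmx G *m h)) v by lra.
  rewrite quadN opprK -QQ quadE.
  rewrite -[X in _ *m X *m _^T]/(h *m (Q *m Q^T) *m h) -{2}hs.
  (* The subtracted term is a squared length, so positivity of Ricci passes to [t * quad h v]. *)
  have -> : v *m (h *m (Q *m Q^T) *m h^T) *m v^T = (v *m h *m Q) *m (v *m h *m Q)^T.
    by rewrite !trmx_mul !mulmxA.
  by rewrite -dotpE dotp_ge0.
have [t0|t0|t0] := ltgtP t 0.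
- right=> v v0; rewrite quadN oppr_gt0.
  by rewrite -(nmulr_rgt0 _ t0) th.
- by left=> v v0; rewrite -(pmulr_rgt0 _ t0) th.
(* A zero trace contradicts [th] at any nonzero vector, so definiteness is vacuous. *)
- by left=> v /th; rewrite t0 mul0r ltxx.
Qed.

End PositiveRicci.
End Algebra.

(** * Directions of increase of a height function *)

Lemma line_increases (R : realType) n (g gv : 'rV[R]_n -> R) (x v : 'rV[R]_n) r :
    (forall y, `|y - x| < r -> is_derive y v g (gv y) /\ 0 < gv y) ->
  forall y t, 0 < t -> `|y - x| < r -> `|y - t *: v - x| < r ->
    g (y - t *: v) < g y.
Proof.
move=> rP y t t0 yr ytr.
have inr s : 0 <= s <= t -> `|y - t *: v + s *: v - x| < r.
  move=> /andP[s0 st]; have := @ball_segment _ _ x r (y - t *: v) y (s / t).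
  rewrite (_ : y - t *: v + (s / t) *: (y - (y - t *: v)) = y - t *: v + s *: v); last first.
    by rewrite subKr scalerA divfK ?gt_eqF.
  by apply => //; rewrite ler_pdivrMr // mul1r st andbT divr_ge0 // ltW.
have dg s : 0 <= s <= t ->
    is_derive (y - t *: v + s *: v) v g (gv (y - t *: v + s *: v)).
  by move=> /inr /rP [].
have [c /andP[c0 ct]] := MVT_line t0 dg.
rewrite subrK => E; rewrite -subr_gt0 E mulr_gt0 //.
by have [] := rP (y - t *: v + c *: v); [apply: inr; rewrite !ltW|].
Qed.

Section RegularDirection.
Variables (R : realType) (n d : nat) (U : set 'rV[R]_n).
Hypothesis oU : open U.
Variables (F : 'rV[R]_n -> 'rV[R]_d) (u : 'rV[R]_d) (x : 'rV[R]_n).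
Hypotheses (sF : smooth_on U F) (Ux : U x).

Lemma regular_direction i : dotp u ('D_(delta_mx 0 i) F x) != 0 ->
  exists v, 0 < dotp u ('D_v F x).
Proof.
have dF := smooth_differentiable sF Ux.
rewrite deriveE //; set a := dotp u _ => a0.
exists (a *: delta_mx 0 i).
by rewrite deriveE // linearZ dotpZr -expr2 exprn_even_gt0.
Qed.

(** By continuity of the derivative one direction [v] works on a whole ball, as
    [chart_passing_regular] requires. *)
Lemma height_increases v : 0 < dotp u ('D_v F x) ->
  exists r, [/\ 0 < r, forall y, `|y - x| < r -> U y &
    forall y t, 0 < t -> `|y - x| < r -> `|y - t *: v - x| < r ->
      dotp u (F (y - t *: v)) < dotp u (F y)].
Proof.
move=> Dpos; pose gv y := dotp u ('D_v F y).
have cgv : gv y @[y --> x] --> gv x.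
  have C := smooth_continuous (smooth_derive v sF) Ux.
  exact: (@cvg_dotp R d _ (nbhs x) (cst u) _ u _ _ (cvg_cst _) C).
have /nbhs_norm[r r0 rP] : \forall y \near x, U y /\ 0 < gv y.
  apply: filterI; first exact: open_nbhs_nbhs.
  by apply: (cgv [set a | 0 < a]); apply: open_nbhs_nbhs; split => //; exact: open_gt.
exists r; split => // [y /rP []//|].
apply: (line_increases (g := fun y => dotp u (F y)) (gv := gv)) => y /rP[Uy gy].
by split => //; apply: is_derive_dotpr; exact: smooth_is_derive sF Uy.
Qed.

End RegularDirection.

(** * Curvature and convexity of a hypersurface in a chart *)

Section ChartGeometry.
Variables (R : realType) (n d : nat) (U : set 'rV[R]_n).
Variables (F : 'rV[R]_n -> 'rV[R]_d) (G : 'rV[R]_n -> 'M[R]_n).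
Hypothesis oU : open U.
Hypothesis sF : smooth_on U F.
Hypothesis immF : forall x, U x -> row_free ('J F x).
Hypothesis isoF : forall x, U x -> 'J F x *m ('J F x)^T = G x.
Let e i : 'rV[R]_n := delta_mx 0 i.

Lemma row_jacobian x i : U x -> row i ('J F x) = 'D_(e i) F x.
Proof.
move=> Ux; rewrite rowE deriveEjacobian //.
exact: smooth_differentiable sF Ux.
Qed.

Lemma hypersurface_ricci x (N : 'rV[R]_d) : U x -> dotp N N = 1 ->
    (forall m, dotp (row m ('J F x)) N = 0) ->
    (forall w, (forall m, dotp w (row m ('J F x)) = 0) -> w = dotp w N *: N) ->
  let h := height_hessian F N x in
  ricci G x = \tr (h *m invmx (G x)) *: h - h *m invmx (G x) *m h.
Proof.
move=> Ux N1 NF NP.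
pose F1 i := 'D_(e i) F; pose F2 i j := 'D_(e i) (F1 j).
pose F3 i j k := 'D_(e i) (F2 j k).
have gramE y i j : U y -> G y i j = dotp (F1 i y) (F1 j y).
  move=> Uy; rewrite -isoF // mxE; apply: eq_bigr => k _.
  by rewrite /F1 -!row_jacobian // !mxE.
have gram_unit y : U y -> G y \in unitmx.
  by move=> Uy; exact: gram_unitmx (immF Uy) (isoF Uy).
have dF1 y i j : U y -> is_derive y (delta_mx 0 i) (F1 j) (F2 i j y).
  by move=> Uy; exact: (smooth_is_derive _ (smooth_derive (e j) sF) Uy).
have dF2 y i j k : U y -> is_derive y (delta_mx 0 i) (F2 j k) (F3 i j k y).
  move=> Uy.
  exact: (smooth_is_derive _ (smooth_derive (e j) (smooth_derive (e k) sF)) Uy).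
have F2C y i j : U y -> F2 i j y = F2 j i y.
  by move=> Uy; exact: (deriveC oU (e i) (e j) sF Uy).
have F3C y i j k : U y -> F3 i j k y = F3 j i k y.
  by move=> Uy; exact: (deriveC oU (e i) (e j) (smooth_derive (e k) sF) Uy).
have NF1 m : dotp (F1 m x) N = 0 by rewrite /F1 -row_jacobian.
have NP1 w : (forall m, dotp w (F1 m x) = 0) -> w = dotp w N *: N.
  by move=> wF; apply: NP => m; rewrite row_jacobian //; exact: wF.
exact: (ricci_gauss oU gramE gram_unit dF1 dF2 F2C F3C Ux N1 NF1 NP1).
Qed.

Variable k : R.
Hypothesis k_gt0 : 0 < k.

Lemma ricci_close_posdef x : U x ->
  tensor_norm G x (ricci G x - k *: G x) <= k / 2 -> posdef (ricci G x).
Proof. by move=> Ux; apply: (posdef_of_close (immF Ux) (isoF Ux) k_gt0). Qed.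

End ChartGeometry.

Section HypersurfaceNormal.
Variables (R : realType) (n : nat).
Implicit Types (G : 'rV[R]_n -> 'M[R]_n).

Lemma riemann_same G l i j x : riemann G l i i j x = 0.
Proof. by rewrite /riemann subrr add0r big1 // => m _; rewrite subrr. Qed.

Lemma posdef_ricci_dim G x : (0 < n)%N -> posdef (ricci G x) -> (1 < n)%N.
Proof.
move=> n0 pR; rewrite ltnNge; apply/negP => n1.
pose i0 := Ordinal n0; have iE (i : 'I_n) : i = i0.
  by apply: val_inj => /=; apply/eqP; rewrite -leqn0 -ltnS (leq_trans (ltn_ord i)).
have R0 : ricci G x = 0.
  apply/matrixP => i j; rewrite mxE [RHS]mxE big1 // => l _.
  by rewrite (iE l) (iE i) riemann_same.
have := pR (delta_mx 0 i0); rewrite R0 quadE mulmx0 mul0mx mxE ltxx => H.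
have : delta_mx 0 i0 != 0 :> 'rV[R]_n.
  by apply/eqP => /rowP/(_ i0)/eqP; rewrite !mxE !eqxx oner_eq0.
by move=> /H.
Qed.

Lemma height_hessianN d (F : 'rV[R]_n -> 'rV[R]_d) N x :
  height_hessian F (- N) x = - height_hessian F N x.
Proof.
by apply/matrixP => i j; rewrite height_hessianE mxE height_hessianE dotpNl.
Qed.

Variables (U : set 'rV[R]_n) (F : 'rV[R]_n -> 'rV[R]_n.+1).
Variables (G : 'rV[R]_n -> 'M[R]_n) (k : R).
Hypothesis oU : open U.
Hypothesis sF : smooth_on U F.
Hypothesis immF : forall x, U x -> row_free ('J F x).
Hypothesis isoF : forall x, U x -> 'J F x *m ('J F x)^T = G x.
Hypothesis k_gt0 : 0 < k.

(** The sign of the normal is fixed by definiteness of the second fundamental form, separately at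
    each point. The last clause lists the only directions for which the point is critical. *)
Lemma convex_normal x : U x ->
    tensor_norm G x (ricci G x - k *: G x) <= k / 2 ->
  exists N, [/\ dotp N N = 1, forall i, dotp N ('D_(delta_mx 0 i) F x) = 0,
    posdef (height_hessian F N x) &
    forall u, dotp u u = 1 ->
      (forall i, dotp u ('D_(delta_mx 0 i) F x) = 0) -> u = N \/ u = - N].
Proof.
move=> Ux close; have pR := ricci_close_posdef immF isoF k_gt0 Ux close.
have [N [N1 NF NP]] := unit_normal (immF Ux).
have RE := hypersurface_ricci oU sF immF isoF Ux N1 NF NP.
have row m := row_jacobian sF m Ux.
have hT : (height_hessian F N x)^T = height_hessian F N x.
  apply/matrixP => i j; rewrite mxE !height_hessianE.
  exact: (congr1 (dotp N) (deriveC oU (delta_mx 0 j) (delta_mx 0 i) sF Ux)).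
have perpN u : dotp u u = 1 ->
    (forall i, dotp u ('D_(delta_mx 0 i) F x) = 0) -> u = N \/ u = - N.
  move=> u1 uF; have uE : u = dotp u N *: N.
    by apply: NP => m; rewrite row; exact: uF.
  have : (dotp u N) ^+ 2 == 1.
    by rewrite -u1 {2 3}uE dotpZl dotpZr N1 mulr1 expr2.
  rewrite sqrf_eq1 => /orP[] /eqP c; rewrite c ?scale1r ?scaleN1r in uE.
    by left.
  by right.
have [p|p] := definite_of_ricci (immF Ux) (isoF Ux) hT pR RE.
  by exists N; split => // i; rewrite -row dotpC.
exists (- N); split.
- by rewrite dotpNl dotpNr opprK.
- by move=> i; rewrite dotpNl -row dotpC NF oppr0.
- by rewrite height_hessianN.
- by move=> u u1 uF; rewrite opprK; have [uN|uN] := perpN u u1 uF; [right|left].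
Qed.

End HypersurfaceNormal.

(** * From charts to the whole hypersurface *)

Section Manifold.
Variables (R : realType) (n : nat) (M : smooth_manifold R n).
Implicit Types (i : chart_index M) (m : M).

Lemma chart_inv_open i x N : cod i x -> nbhs x N ->
  nbhs (chart_inv i x) (chart_inv i @` N).
Proof.
move=> ix xN; have dx := chart_inv_dom ix.
have cx : {for chart_inv i x, continuous (chart i)} := chart_continuous dx.
have cN : nbhs (chart_inv i x) (chart i @^-1` N).
  by apply: cx; rewrite chart_invK.
have dN : nbhs (chart_inv i x) (dom i) by apply: open_nbhs_nbhs; split => //; exact: dom_open.
apply: filterS (filterI dN cN) => y [dy Ny]; exists (chart i y) => //.
exact: chartK.
Qed.

Lemma manifold_locally_connected : locally_connected M.
Proof.
move=> m N mN; pose i := chart_at m.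
have dm : dom i m := chart_at_dom m.
have := @chart_locally_connected R n M (cod i) (chart_inv i) (@cod_open _ _ _ i)
  (@chart_inv_continuous _ _ _ i) (@chart_inv_open i) (chart i m) N (chart_cod dm).
by rewrite chartK //; apply.
Qed.

Variables (g : riemannian_metric M) (phi : M -> 'rV[R]_n.+1) (k : R).
Hypothesis n_gt0 : (0 < n)%N.
Hypothesis k_gt0 : 0 < k.
Hypothesis imm : smooth_immersion phi.
Hypothesis iso : isometric g phi.
Hypothesis close : forall m, ricci_deviation g k m <= k / 2.

Lemma immersion_continuous : continuous phi.
Proof.
move=> m; pose i := chart_at m.
have dm : dom i m := chart_at_dom m.
have c1 : {for m, continuous (chart i)} := chart_continuous dm.
have c2 := smooth_continuous (imm i).1 (chart_cod dm).
have c3 : (phi \o chart_inv i \o chart i) y @[y --> m] --> phi m.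
  by rewrite -{2}(chartK dm); exact: continuous_comp c1 c2.
apply: cvg_trans c3; apply: near_eq_cvg.
have : nbhs m (dom i) by apply: open_nbhs_nbhs; split => //; exact: dom_open.
by apply: filterS => y dy /=; rewrite chartK.
Qed.

(** A direction that is not normal at [m] makes it a regular point of the height, and [- N] makes it
    a strict maximum; both are passing points, which leaves [N] alone. *)
Lemma height_critical_points m :
  exists2 N, dotp N N = 1 /\ strict_local_min (fun y => dotp N (phi y)) m &
    forall u, dotp u u = 1 -> u = N \/ passing_point (fun y => dotp u (phi y)) m.
Proof.
pose i := chart_at m; pose psi := chart_inv i; pose x := chart i m.
have dm : dom i m := chart_at_dom m.
have Ux : cod i x := chart_cod dm.
have oU : open (cod i) := @cod_open _ _ _ i.
have mE : psi x = m by rewrite /psi chartK.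
have [sF immF] := imm i; have isoF := @iso i.
have psi_cont := @chart_inv_continuous _ _ M i.
have psi_open := @chart_inv_open i.
have [N [N1 NF pH perpN]] := convex_normal oU sF immF isoF k_gt0 Ux (close m).
have n1 : (1 < n)%N.
  exact: posdef_ricci_dim n_gt0 (ricci_close_posdef immF isoF k_gt0 Ux (close m)).
have [r r0 rP] := local_extremum_height oU sF Ux NF pH.
exists N; first (split => //).
  have := @chart_strict_local_min R n M (cod i) psi psi_open (fun y => dotp N (phi y)) x Ux r r0.
  by rewrite mE; apply => y yr yx; have [_ /(_ yx)] := rP y yr; rewrite -mE.
move=> u u1.
have hc : continuous (fun y => dotp u (phi y)).
  exact: (@height_continuous _ _ _ _ immersion_continuous u).
have [uF|/existsNP[j /eqP uj]] := pselect (forall j, dotp u ('D_(delta_mx 0 j) (phi \o psi) x) = 0).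
  have [->|uN] := perpN u u1 uF; [by left|right].
  (* Dimension at least 2 supplies the two axes used to go around a maximum. *)
  have ij : Ordinal n_gt0 != Ordinal n1 by [].
  have := @chart_passing_max R n M (cod i) psi psi_cont psi_open
    (fun y => dotp u (phi y)) x Ux r _ _ r0 ij.
  rewrite mE; apply => y yr; first by have [] := rP y yr.
  by move=> yx; rewrite -mE uN !dotpNl ltrN2; have [_] := rP y yr; apply.
right; have [v Dv] := regular_direction sF Ux uj.
have [s [s0 sU sP]] := height_increases oU sF Ux Dv.
rewrite -mE.
exact: (@chart_passing_regular R n M (cod i) psi psi_cont psi_open
  (fun y => dotp u (phi y)) x Ux hc v s s0 sU).
Qed.

Lemma homeomorphic_of_close : compact [set: M] -> connected [set: M] ->
  homeomorphic M (set_type (@unit_sphere R n)).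
Proof.
move=> cM coM; have hM := @points_hausdorff _ _ M.
have sphereE u : unit_sphere u -> dotp u u = 1.
  by move=> <-; apply: eq_bigr => i _; rewrite expr2.
(* A passing point has lower points nearby, so a lowest point can only be the strict minimum. *)
have lowest_strict u m : dotp u u = 1 -> lowest_at phi u m ->
    strict_local_min (fun y => dotp u (phi y)) m.
  move=> u1 um; have [N [N1 sN] NP] := height_critical_points m.
  have [->//|/passing_point_not_min[y]] := NP u u1.
  by rewrite ltNge um.
have uniq u m m' : dotp u u = 1 ->
    strict_local_min (fun y => dotp u (phi y)) m ->
    strict_local_min (fun y => dotp u (phi y)) m' -> m = m'.
  move=> u1; apply: unique_strict_local_min => //.
  - exact: manifold_locally_connected.
  - exact: (@height_continuous _ _ _ _ immersion_continuous u).
  - move=> y; have [N [N1 sN] NP] := height_critical_points y.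
    by have [->|] := NP u u1; [left|right].
apply: homeomorphic_sphere => //.
- exact: immersion_continuous.
- move=> u m m' /sphereE u1 um um'.
  by apply: (uniq u) => //; exact: lowest_strict.
- move=> m; have [N [N1 sN] NP] := height_critical_points m.
  exists N; first by rewrite /unit_sphere /= -N1; apply: eq_bigr => i _; rewrite expr2.
  (* The strict local minimum at [m] is global: the lowest point in direction [N] is also a strict
     local minimum, hence equal to [m]. *)
  have [m' m'N] := lowest_point cM immersion_continuous N.
  by rewrite (uniq N m m') //; exact: lowest_strict.
- move=> u u' m /sphereE u1 /sphereE u'1 um um'.
  have [N [N1 sN] NP] := height_critical_points m.
  have normalE w : dotp w w = 1 -> lowest_at phi w m -> w = N.
    move=> w1 wm; have [//|/passing_point_not_min[y]] := NP w w1.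
    by rewrite ltNge wm.
  by rewrite (normalE u) // (normalE u').
Qed.

End Manifold.


Theorem theorem3 (R : realType) :
  exists eps : R -> nat -> \bar R -> R,
    (forall (k : R) (n : nat) (L : \bar R), 0 < k -> 0 < eps k n L) /\
    (forall (n : nat) (M : smooth_manifold R n) (g : riemannian_metric M)
        (mu : {measure set (borel M) -> \bar R}) (phi : M -> 'rV[R]_n.+1)
        (p k : R),
      (0 < n)%N ->
      compact [set: M] -> connected [set: M] ->
      oriented M ->
      is_riemannian_measure g mu ->
      smooth_immersion phi -> isometric g phi ->
      n%:R / 2 < p ->
      0 < k ->
      (ricci_deviation_sup g k <=
        (eps k n 'N[mu]_((2 * p)%:E)[EFin \o (max_sectional g)])%:E)%E ->
      homeomorphic M (set_type (@unit_sphere R n))).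
Proof.
exists (fun k _ _ => k / 2); split; first by move=> k n L k0; rewrite divr_gt0.
move=> n M g mu phi p k n0 cM coM _ _ imm iso _ k0 close.
apply: homeomorphic_of_close n0 k0 imm iso _ cM coM => m.
rewrite -lee_fin; apply: le_trans close.
by apply: ereal_sup_ubound; exists m.
Qed.
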